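(* Let $R$ be a commutative noetherian ring, $C$ a semidualizing $R$-module, $M$ an $R$-module, and assume that $x,y\in R$ form a pair of exact zero-divisors on both $R$ and $M$. (i) If $M\in\mathcal G_C(R)$, then $M/xM\in\mathcal G_C(R)$ if and only if $x,y$ form also a pair of exact zero-divisors on $\operatorname{Hom}_R(M,C)$. (ii) If $M\in\mathcal B_C(R)$, then $M/xM\in\mathcal B_C(R)$ if and only if $x,y$ form also a pair of exact zero-divisors on $\operatorname{Hom}_R(C,M)$. (iii) If $M\in\mathcal A_C(R)$ is finite, then $M/xM\in\mathcal A_C(R)$ if and only if $x,y$ form also a pair of exact zero-divisors on $C\otimes_RM$.
   Context: Rings are commutative noetherian with identity; ''finite'' means finitely generated. A finite $R$-module $C$ is semidualizing if the natural homothety map $R\to\operatorname{Hom}_R(C,C)$ is an isomorphism and $\operatorname{Ext}^i_R(C,C)=0$ for all $i>0$. For an $R$-module $N$ and $x,y\in R$, one says that $x,y$ form a pair of exact zero-divisors on $N$ if $xN\neq 0$, $xN\neq N$ and the sequence of multiplication maps $N\xrightarrow{x}N\xrightarrow{y}N\xrightarrow{x}N$ is exact. $\mathcal G_C(R)$ is the class of $\mathrm G_C$-projective $R$-modules, i.e. all finite $R$-modules $N$ such that, writing $(-)^\dagger=\operatorname{Hom}_R(-,C)$: (i) the natural biduality map $N\to N^{\dagger\dagger}$ is an isomorphism; (ii) $\operatorname{Ext}^i_R(N,C)=0=\operatorname{Ext}^i_R(N^\dagger,C)$ for all $i>0$. The Auslander class $\mathcal A_C(R)$ is the class of all $R$-modules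 $N$ (not necessarily finite) such that (1) the natural map $N\to\operatorname{Hom}_R(C,C\otimes_RN)$, $n\mapsto(c\mapsto c\otimes n)$, is an isomorphism; (2) $\operatorname{Tor}^R_i(C,N)=0=\operatorname{Ext}^i_R(C,C\otimes_RN)$ for all $i>0$. The Bass class $\mathcal B_C(R)$ is the class of all $R$-modules $N$ (not necessarily finite) such that (1) the evaluation map $C\otimes_R\operatorname{Hom}_R(C,N)\to N$ is an isomorphism; (2) $\operatorname{Ext}^i_R(C,N)=0=\operatorname{Tor}^R_i(C,\operatorname{Hom}_R(C,N))$ for all $i>0$. *)

(* Defs.v *)
(* Classical logic (boolp) turns Prop-valued predicates into booleans and
   provides the choice structure on linear maps. *)
From HB Require Import structures.
From mathcomp Require Import all_boot all_algebra.
From mathcomp Require Import generic_quotient boolp.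
From mathcomp Require Import freeg.

Set Implicit Arguments.
Unset Strict Implicit.
Unset Printing Implicit Defensive.

Import GRing.Theory.
Local Open Scope ring_scope.
Local Open Scope quotient_scope.

Section Submodule.
Variables (R : comNzRingType) (V : lmodType R) (S : submodClosed V).

Record submod := Submod { submod_val : V; _ : submod_val \in S }.

HB.instance Definition _ := [isSub for submod_val].
HB.instance Definition _ := [Choice of submod by <:].
HB.instance Definition _ := [SubChoice_isSubLmodule of submod by <:].

End Submodule.

Section Quotient.
Variables (R : comNzRingType) (V : lmodType R) (S : submodClosed V).

Definition equivm (u v : V) := u - v \in S.

Lemma equivmE u v : equivm u v = (u - v \in S). Proof. by []. Qed.

(* [submodClosed] is defined over semimodules, so that [rpredN] and [rpredB]
   do not apply. *)
Lemma submodN u : (- u \in S) = (u \in S).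
Proof.
have imp v : v \in S -> - v \in S by move=> vS; rewrite -scaleN1r rpredZ.
by apply/idP/idP=> /imp //; rewrite opprK.
Qed.

Lemma equivm_is_equiv : equiv_class_of equivm.
Proof.
split=> [u|u v|v u w]; rewrite !equivmE.
- by rewrite subrr rpred0.
- by rewrite -[u - v]opprB submodN.
- by move=> uv vw; rewrite -(subrKA v) rpredD.
Qed.

Canonical equivm_equiv := EquivRelPack equivm_is_equiv.

Definition quotm := {eq_quot equivm}.

HB.instance Definition _ := Choice.on quotm.

Definition quotm_pi : V -> quotm := \pi_quotm.
Local Notation pi := quotm_pi.

Lemma quotm_pi_eqP u v : reflect (pi u = pi v) (u - v \in S).
Proof. by apply: (iffP idP) => [uv|/eqP]; [apply/eqP|]; rewrite /pi piE. Qed.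

Lemma quotm_pi_repr (u : quotm) : pi (repr u) = u.
Proof. exact: reprK. Qed.

Lemma quotm_piK v : repr (pi v) - v \in S.
Proof. by apply/quotm_pi_eqP; rewrite quotm_pi_repr. Qed.

Definition quotm_add (u v : quotm) := pi (repr u + repr v).
Definition quotm_opp (u : quotm) := pi (- repr u).
Definition quotm_scale (a : R) (u : quotm) := pi (a *: repr u).

Lemma quotm_piD u v : quotm_add (pi u) (pi v) = pi (u + v).
Proof. by apply/quotm_pi_eqP; rewrite opprD addrACA rpredD ?quotm_piK. Qed.
Lemma quotm_piN u : quotm_opp (pi u) = pi (- u).
Proof. by apply/quotm_pi_eqP; rewrite -opprD submodN quotm_piK. Qed.
Lemma quotm_piZ a u : quotm_scale a (pi u) = pi (a *: u).
Proof. by apply/quotm_pi_eqP; rewrite -scalerBr rpredZ ?quotm_piK. Qed.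

Fact quotm_addA : associative quotm_add.
Proof.
move=> u v w; rewrite -[u]quotm_pi_repr -[v]quotm_pi_repr -[w]quotm_pi_repr.
by rewrite !quotm_piD addrA.
Qed.
Fact quotm_addC : commutative quotm_add.
Proof. by move=> u v; rewrite /quotm_add addrC. Qed.
Fact quotm_add0 : left_id (pi 0) quotm_add.
Proof. by move=> u; rewrite -[u]quotm_pi_repr quotm_piD add0r. Qed.
Fact quotm_addN : left_inverse (pi 0) quotm_opp quotm_add.
Proof. by move=> u; rewrite -[u]quotm_pi_repr quotm_piN quotm_piD addNr. Qed.

HB.instance Definition _ := GRing.isZmodule.Build quotm
  quotm_addA quotm_addC quotm_add0 quotm_addN.

Fact quotm_scaleA a b u :
  quotm_scale a (quotm_scale b u) = quotm_scale (a * b) u.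
Proof. by rewrite -[u]quotm_pi_repr !quotm_piZ scalerA. Qed.
Fact quotm_scale1 : left_id 1 quotm_scale.
Proof. by move=> u; rewrite -[u]quotm_pi_repr quotm_piZ scale1r. Qed.
Fact quotm_scaleDr : right_distributive quotm_scale +%R.
Proof.
move=> a u v; rewrite -[u]quotm_pi_repr -[v]quotm_pi_repr.
by rewrite [_ + _]quotm_piD !quotm_piZ [RHS]quotm_piD scalerDr.
Qed.
Fact quotm_scaleDl u : {morph quotm_scale^~ u : a b / a + b}.
Proof.
move=> a b; rewrite -[u]quotm_pi_repr !quotm_piZ.
by rewrite [RHS]quotm_piD scalerDl.
Qed.

HB.instance Definition _ := GRing.Zmodule_isLmodule.Build R quotm
  quotm_scaleA quotm_scale1 quotm_scaleDr quotm_scaleDl.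

Fact quotm_pi_is_linear : linear pi.
Proof. by move=> a u v; rewrite -quotm_piD -quotm_piZ. Qed.
HB.instance Definition _ := GRing.isLinear.Build R V quotm _ pi
  quotm_pi_is_linear.

End Quotient.

Section KernelImage.
Variables (R : comNzRingType) (U V : lmodType R) (f : {linear U -> V}).

Let kerm_pred : pred U := fun u => f u == 0.
Fact kerm_closed : subsemimod_closed kerm_pred.
Proof.
split; first split.
- by apply/eqP; rewrite raddf0.
- by move=> u v /eqP fu /eqP fv; apply/eqP; rewrite raddfD /= fu fv addr0.
- by move=> a u /eqP fu; apply/eqP; rewrite linearZ /= fu scaler0.
Qed.
Definition kerm : submodClosed U :=
  HB.pack kerm_pred (GRing.isSubmodClosed.Build R U kerm_pred kerm_closed).

Let imgm_pred : pred V := fun v => `[< exists u, f u = v >].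
Fact imgm_closed : subsemimod_closed imgm_pred.
Proof.
split; first split.
- by apply/asboolP; exists 0; rewrite raddf0.
- move=> _ _ /asboolP[u <-] /asboolP[v <-].
  by apply/asboolP; exists (u + v); rewrite raddfD.
- by move=> a _ /asboolP[u <-]; apply/asboolP; exists (a *: u); rewrite linearZ.
Qed.
Definition imgm : submodClosed V :=
  HB.pack imgm_pred (GRing.isSubmodClosed.Build R V imgm_pred imgm_closed).

End KernelImage.

Section Preimage.
Variables (R : comNzRingType) (U V : lmodType R) (f : {linear U -> V}).
Variable S : submodClosed V.

Let preimm_pred : pred U := fun u => f u \in S.
Fact preimm_closed : subsemimod_closed preimm_pred.
Proof.
split; first split.
- by rewrite unfold_in /preimm_pred raddf0 rpred0.
- by move=> u v fu fv; rewrite unfold_in /preimm_pred raddfD rpredD.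
- by move=> a u fu; rewrite unfold_in /preimm_pred linearZ rpredZ.
Qed.
Definition preimm : submodClosed U :=
  HB.pack preimm_pred (GRing.isSubmodClosed.Build R U preimm_pred preimm_closed).

End Preimage.

(* The submodule generated by a set, as the intersection of the submodules
   that contain it. *)
Section Span.
Variables (R : comNzRingType) (V : lmodType R) (E : V -> Prop).

Let spanm_pred : pred V := fun v =>
  `[< forall S : submodClosed V, (forall e, E e -> e \in S) -> v \in S >].
Fact spanm_closed : subsemimod_closed spanm_pred.
Proof.
split; first split.
- by apply/asboolP=> S _; rewrite rpred0.
- move=> u v /asboolP uE /asboolP vE.
  by apply/asboolP=> S SE; rewrite rpredD ?uE ?vE.
- by move=> a u /asboolP uE; apply/asboolP=> S SE; rewrite rpredZ ?uE.
Qed.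
Definition spanm : submodClosed V :=
  HB.pack spanm_pred (GRing.isSubmodClosed.Build R V spanm_pred spanm_closed).

End Span.

Section Hom.
Variables (R : comNzRingType) (U V : lmodType R).
Local Notation hom := {linear U -> V}.
Implicit Types f g h : hom.

Lemma homP f g : f =1 g -> f = g.
Proof.
case: f g => [f [[fD] [fZ]]] [g [[gD] [gZ]]] /= /funext fg.
rewrite {}fg in fD fZ *.
by rewrite (Prop_irrelevance fD gD) (Prop_irrelevance fZ gZ).
Qed.

HB.instance Definition _ := gen_eqMixin hom.
HB.instance Definition _ := gen_choiceMixin hom.

Definition hom_zero : hom := \0.
Definition hom_opp f : hom := \- f.
Definition hom_add f g : hom := f \+ g.
Definition hom_scale (a : R) f : hom := a \*: f.

Fact hom_addA : associative hom_add.
Proof. by move=> f g h; apply: homP => u; exact: addrA. Qed.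
Fact hom_addC : commutative hom_add.
Proof. by move=> f g; apply: homP => u; exact: addrC. Qed.
Fact hom_add0 : left_id hom_zero hom_add.
Proof. by move=> f; apply: homP => u; exact: add0r. Qed.
Fact hom_addN : left_inverse hom_zero hom_opp hom_add.
Proof. by move=> f; apply: homP => u; exact: addNr. Qed.
HB.instance Definition _ := GRing.isZmodule.Build hom
  hom_addA hom_addC hom_add0 hom_addN.

Fact hom_scaleA a b f : hom_scale a (hom_scale b f) = hom_scale (a * b) f.
Proof. by apply: homP => u; exact: scalerA. Qed.
Fact hom_scale1 : left_id 1 hom_scale.
Proof. by move=> f; apply: homP => u; exact: scale1r. Qed.
Fact hom_scaleDr : right_distributive hom_scale +%R.
Proof. by move=> a f g; apply: homP => u; exact: scalerDr. Qed.
Fact hom_scaleDl f : {morph hom_scale^~ f : a b / a + b}.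
Proof. by move=> a b; apply: homP => u; exact: scalerDl. Qed.
HB.instance Definition _ := GRing.Zmodule_isLmodule.Build R hom
  hom_scaleA hom_scale1 hom_scaleDr hom_scaleDl.

End Hom.

Section HomMaps.
Variables (R : comNzRingType) (U V W : lmodType R).

Definition hom_precomp (d : {linear U -> V}) (f : {linear V -> W}) :
  {linear U -> W} := f \o d.
Fact hom_precomp_is_linear d : linear (hom_precomp d).
Proof. by move=> a f g; apply: homP. Qed.
HB.instance Definition _ d := GRing.isLinear.Build R
  {linear V -> W} {linear U -> W} _ (hom_precomp d) (hom_precomp_is_linear d).

Definition hom_map (d : {linear U -> V}) :
  {linear {linear V -> W} -> {linear U -> W}} := hom_precomp d.

End HomMaps.

Arguments hom_map {R U V} W d.

Section FreeModule.
Variables (R : comNzRingType) (K : choiceType) (V : lmodType R) (f : K -> V).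

Definition freelift : {freeg K / R} -> V := fglift f.
HB.instance Definition _ := GRing.isZmodMorphism.Build {freeg K / R} V freelift
  (lift_is_additive f).

Fact freelift_is_scalable : scalable freelift.
Proof.
move=> a D; have -> : a *: D = fgscale a D by [].
rewrite /fgscale -[X in _ = _ *: freelift X]freeg_sumE !raddf_sum.
by apply: eq_bigr => k _; rewrite /= /freelift !liftU scalerA.
Qed.
HB.instance Definition _ := GRing.isScalable.Build R {freeg K / R} V _ freelift
  freelift_is_scalable.

End FreeModule.

Section Tensor.
Variables (R : comNzRingType) (U V : lmodType R).

Local Notation F := {freeg (U * V) / R}.
Local Notation "<< u , v >>" := (<< 1 *g (u, v) >> : F).

Inductive tensor_rel : F -> Prop :=
| TensorDl u u' v : tensor_rel (<< u + u', v >> - (<< u, v >> + << u', v >>))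
| TensorDr u v v' : tensor_rel (<< u, v + v' >> - (<< u, v >> + << u, v' >>))
| TensorZl a u v : tensor_rel (<< a *: u, v >> - a *: << u, v >>)
| TensorZr a u v : tensor_rel (<< u, a *: v >> - a *: << u, v >>).

Definition tensor : lmodType R := quotm (spanm tensor_rel).

Definition tens (u : U) (v : V) : tensor := quotm_pi _ << u, v >>.

Fact tens_is_bilinear : bilinear_for *:%R *:%R tens.
Proof.
have tensP z : tensor_rel z -> z \in spanm tensor_rel.
  by move=> relz; apply/asboolP=> S; apply.
split=> [v a u u'|u a v v'].
- rewrite -linearP; apply/quotm_pi_eqP.
  rewrite -(subrKA (<< a *: u, v >> + << u', v >>)) rpredD //.
    exact/tensP/TensorDl.
  by rewrite opprD addrACA subrr addr0; exact/tensP/TensorZl.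
- rewrite -linearP; apply/quotm_pi_eqP.
  rewrite -(subrKA (<< u, a *: v >> + << u, v' >>)) rpredD //.
    exact/tensP/TensorDr.
  by rewrite opprD addrACA subrr addr0; exact/tensP/TensorZr.
Qed.
HB.instance Definition _ :=
  bilinear_isBilinear.Build R U V tensor _ _ tens tens_is_bilinear.

Section Lift.
Variables (W : lmodType R) (b : {bilinear U -> V -> W}).

Definition tensor_lift (t : tensor) : W :=
  freelift (fun p : U * V => b p.1 p.2) (repr t).

Lemma tensor_rel_lift z :
  z \in spanm tensor_rel -> freelift (fun p : U * V => b p.1 p.2) z = 0.
Proof.
move=> /asboolP /(_ (kerm (freelift (fun p : U * V => b p.1 p.2)))) zS.
apply/eqP/zS => _ [u u' v|u v v'|a u v|a u v]; apply/eqP;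
  rewrite raddfB ?raddfD /= ?freelift_is_scalable /freelift !liftU !scale1r /=.
- by rewrite linearDl -opprD subrr.
- by rewrite linearDr -opprD subrr.
- by rewrite linearZl_LR subrr.
- by rewrite linearZr_LR subrr.
Qed.

Lemma tensor_lift_pi z :
  tensor_lift (quotm_pi _ z) = freelift (fun p : U * V => b p.1 p.2) z.
Proof.
by apply/subr0_eq; rewrite -raddfB /= tensor_rel_lift ?quotm_piK.
Qed.

Lemma tensor_lift_tens u v : tensor_lift (tens u v) = b u v.
Proof. by rewrite tensor_lift_pi [freelift _ _]liftU scale1r. Qed.

Fact tensor_lift_is_linear : linear tensor_lift.
Proof.
move=> a s t; rewrite -[s]quotm_pi_repr -[t]quotm_pi_repr -linearP.
by rewrite !tensor_lift_pi linearP.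
Qed.
HB.instance Definition _ := GRing.isLinear.Build R tensor W _ tensor_lift
  tensor_lift_is_linear.

End Lift.
End Tensor.

Section TensorMaps.
Variables (R : comNzRingType) (U U' V : lmodType R).

Section MapLeft.
Variable d : {linear U -> U'}.

Definition tens_left (u : U) (v : V) : tensor U' V := tens (d u) v.
Fact tens_left_is_bilinear : bilinear_for *:%R *:%R tens_left.
Proof.
by split=> [v a u u'|u a v v']; rewrite /tens_left ?linearP ?linearPl ?linearPr.
Qed.
HB.instance Definition _ :=
  bilinear_isBilinear.Build R U V (tensor U' V) _ _ tens_left
    tens_left_is_bilinear.

Definition tensor_map : {linear tensor U V -> tensor U' V} :=
  tensor_lift tens_left.

End MapLeft.

Definition hom_app (u : U) (f : {linear U -> V}) : V := f u.
Fact hom_app_is_bilinear : bilinear_for *:%R *:%R hom_app.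
Proof. by split=> // f a u u'; exact: linearP. Qed.
HB.instance Definition _ :=
  bilinear_isBilinear.Build R U {linear U -> V} V _ _ hom_app
    hom_app_is_bilinear.

End TensorMaps.

(* Ker g / Im f, which is meaningful when g \o f = 0. *)
Definition homology (R : comNzRingType) (U V W : lmodType R)
    (f : {linear U -> V}) (g : {linear V -> W}) : lmodType R :=
  quotm (preimm (val : submod (kerm g) -> V) (imgm f)).

Section Resolution.
Variable R : comNzRingType.

Definition aug (M : lmodType R) : {linear {freeg M / R} -> M} := freelift idfun.

(* The standard free resolution of M: the module in degree i is free on the
   underlying set of the i-th syzygy, and maps onto that syzygy. *)
Fixpoint syz (M : lmodType R) (i : nat) : lmodType R :=
  if i is j.+1 then submod (kerm (aug (syz M j))) else M.

Definition res (M : lmodType R) (i : nat) : lmodType R := {freeg (syz M i) / R}.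

Definition dres (M : lmodType R) (i : nat) :
    {linear res M i.+1 -> res M i} :=
  (val : submod (kerm (aug (syz M i))) -> res M i) \o aug (syz M i.+1).

Lemma aug_surj (M : lmodType R) m : aug M << 1 *g m >> = m.
Proof. by rewrite [LHS]liftU scale1r. Qed.

Lemma dres0_exact (M : lmodType R) z :
  aug M z = 0 <-> exists w, dres M 0 w = z.
Proof.
split=> [/eqP z0|[w <-]]; last exact/eqP/(valP (aug (syz M 1) w)).
exists << 1 *g (@Submod _ _ (kerm (aug M)) z z0 : syz M 1) >>.
by rewrite /dres /= aug_surj.
Qed.

Lemma dres_exact (M : lmodType R) i z :
  dres M i z = 0 <-> exists w, dres M i.+1 w = z.
Proof.
have valE (t : syz M i.+1) : val t = 0 <-> t = 0.
  by split=> [t0|->]; [apply: val_inj|]; rewrite ?t0 raddf0.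
rewrite -(dres0_exact (M := syz M i.+1)) /dres /=; exact: valE.
Qed.

Definition Ext (i : nat) (M N : lmodType R) : lmodType R :=
  if i is j.+1 then homology (hom_map N (dres M j)) (hom_map N (dres M j.+1))
  else submod (kerm (hom_map N (dres M 0))).

Definition Tor (i : nat) (M N : lmodType R) : lmodType R :=
  if i is j.+1 then homology (tensor_map N (dres M j.+1)) (tensor_map N (dres M j))
  else quotm (imgm (tensor_map N (dres M 0))).

End Resolution.

Section Classes.
Variable R : comNzRingType.
Implicit Types (M N C : lmodType R) (x y : R).

Definition zero_module M : Prop := forall m : M, m = 0.

Definition finite_module M : Prop :=
  exists n (g : 'I_n -> M), forall m, exists a : 'I_n -> R,
    m = \sum_(i < n) a i *: g i.

Definition noetherian : Prop := forall I : submodClosed R^o,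
  finite_module (submod I).

Definition mulm M x : {linear M -> M} := x \*: idfun.

(* M / xM *)
Definition quot_by M x : lmodType R := quotm (imgm (mulm M x)).

Definition exact_at (U V W : lmodType R) (f : {linear U -> V})
    (g : {linear V -> W}) : Prop :=
  forall v, g v = 0 <-> exists u, f u = v.

Definition exact_zero_divisors x y N : Prop :=
  [/\ exists n, mulm N x n <> 0,
      exists n, ~ exists m, mulm N x m = n,
      exact_at (mulm N x) (mulm N y) &
      exact_at (mulm N y) (mulm N x)].

Definition homothety C (a : R) : {linear C -> C} := mulm C a.

Definition semidualizing C : Prop :=
  [/\ finite_module C, bijective (homothety C) &
      forall i, (0 < i)%N -> zero_module (Ext i C C)].

Section Biduality.
Variables C N : lmodType R.

Definition biduality_fun (n : N) (f : {linear N -> C}) : C := f n.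
Fact biduality_fun_is_linear n : linear (biduality_fun n).
Proof. by []. Qed.
HB.instance Definition _ n := GRing.isLinear.Build R {linear N -> C} C _
  (biduality_fun n) (biduality_fun_is_linear n).

Definition biduality (n : N) : {linear {linear N -> C} -> C} :=
  biduality_fun n.

End Biduality.

Definition unit_map C N (n : N) : {linear C -> tensor C N} :=
  applyr (@tens R C N) n.

Definition eval_map C N : {linear tensor C {linear C -> N} -> N} :=
  tensor_lift (@hom_app R C N).

Definition G_class C N : Prop :=
  [/\ finite_module N, bijective (@biduality C N) &
      forall i, (0 < i)%N ->
        zero_module (Ext i N C) /\ zero_module (Ext i {linear N -> C} C)].

Definition Auslander_class C N : Prop :=
  bijective (@unit_map C N) /\
  forall i, (0 < i)%N ->
    zero_module (Tor i C N) /\ zero_module (Ext i C (tensor C N)).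

Definition Bass_class C N : Prop :=
  bijective (eval_map C N) /\
  forall i, (0 < i)%N ->
    zero_module (Ext i C N) /\ zero_module (Tor i C {linear C -> N}).

End Classes.

(* Main.v *)
Require Import Defs.
From HB Require Import structures.
From mathcomp Require Import all_boot all_algebra.
From mathcomp Require Import generic_quotient boolp.
From mathcomp Require Import freeg.

Set Implicit Arguments.
Unset Strict Implicit.
Unset Printing Implicit Defensive.

Import GRing.Theory.
Local Open Scope ring_scope.

(* If multiplication by x and y is exact on N, then n |-> xn and n |-> yn embed
   N/yN and N/xN into N with cokernels N/xN and N/yN. When the derived functors
   of F vanish on N, the long exact sequences of these two short exact sequences
   shift the higher derived functors of N/xN to those of N/yN and back, so that
   they all vanish as soon as the two lowest ones do, which says exactly that x
   and y are exact on F(N). This applies to F = Hom(-, C), Hom(C, -) and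
   C (x) -, and F(N/xN) is then F(N)/xF(N), on which the same criterion can be
   used again. That x and y act nontrivially on F(M) follows from recovering M
   from F(M) by the biduality, evaluation or unit isomorphism: a ring element
   that kills F(M) kills M. *)

(** * Linear maps and free modules *)

Section LinearMaps.
Variable R : comNzRingType.
Implicit Types A B K N P Q : lmodType R.

Definition surj A B (f : A -> B) : Prop := forall b, exists a, f a = b.

Definition short_exact K P A (k : {linear K -> P}) (p : {linear P -> A}) :=
  [/\ injective k, exact_at k p & surj p].

(** Vanishing of Ext and Tor passes to direct summands, so a pair of retracts, one each way, stands
    in for an isomorphism below. *)
Definition retract A B : Prop :=
  exists (i : {linear A -> B}) (r : {linear B -> A}), cancel i r.

Lemma linear_of A B (f : A -> B) :
  linear f -> exists g : {linear A -> B}, g =1 f.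
Proof.
move=> fL; pose g : {linear A -> B} :=
  HB.pack f (GRing.isLinear.Build R A B _ f fL).
by exists g.
Qed.

Lemma ker0_inj A B (f : {linear A -> B}) :
  (forall a, f a = 0 -> a = 0) -> injective f.
Proof. by move=> f0 a b ab; apply/subr0_eq/f0; rewrite linearB /= ab subrr. Qed.

Lemma factor_surj P A N (p : {linear P -> A}) (f : {linear P -> N}) :
  surj p -> (forall u, p u = 0 -> f u = 0) ->
  exists g : {linear A -> N}, forall u, g (p u) = f u.
Proof.
move=> /choice[s sK] f0.
have fE u v : p u = p v -> f u = f v.
  move=> uv; apply/subr0_eq; rewrite -linearB; apply: f0.
  by rewrite linearB /= uv subrr.
(* The section [s] need not be linear, but by [fE] the composite does not depend on the chosen
   preimages, which makes it linear. *)
have [|g gE] := @linear_of A N (f \o s).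
  by move=> a u v /=; rewrite -linearP; apply: fE; rewrite linearP !sK.
by exists g => u; rewrite gE; apply: fE; rewrite sK.
Qed.

Lemma lift_inj K P Q (k : {linear K -> P}) (f : {linear Q -> P}) :
  injective k -> (forall q, exists u, k u = f q) ->
  exists g : {linear Q -> K}, forall q, k (g q) = f q.
Proof.
move=> k_inj /choice[g gE].
have [|h hE] := @linear_of Q K g; last by exists h => q; rewrite hE gE.
by move=> a u v; apply: k_inj; rewrite linearP !gE linearP.
Qed.

Lemma bij_retract A B (f : {linear A -> B}) :
  injective f -> surj f -> retract A B /\ retract B A.
Proof.
move=> f_inj f_surj; have [g gE] := lift_inj (f := idfun) f_inj f_surj.
by split; [exists f, g => a; apply: f_inj; rewrite gE|exists g, f].
Qed.

Lemma retract_trans A B N : retract A B -> retract B N -> retract A N.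
Proof.
move=> [i [r iK]] [j [s jK]]; exists (j \o i), (r \o s) => a /=.
by rewrite jK iK.
Qed.

Lemma ker_short_exact P A (p : {linear P -> A}) : surj p ->
  short_exact (val : submod (kerm p) -> P) p.
Proof.
move=> p_surj; split=> //; first exact: val_inj.
move=> u; split=> [/eqP u0|[v <-]]; last exact/eqP/(valP v).
by exists (@Submod _ _ (kerm p) u u0).
Qed.

Lemma kernel_exists P A (p : {linear P -> A}) : surj p ->
  exists (W : lmodType R) (w : {linear W -> P}), short_exact w p.
Proof. by move/ker_short_exact; exists (submod (kerm p)), val. Qed.

End LinearMaps.

(** * Fibre products of modules *)

Section Pullback.
Variables (R : comNzRingType) (P F A : lmodType R).
Variables (p : {linear P -> A}) (q : {linear F -> A}).

(** The fibre product of P and F over A is encoded as the kernel of this map. *)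
Definition pb_diff (w : P * F) : A := p w.1 - q w.2.
Fact pb_diff_is_linear : linear pb_diff.
Proof.
move=> a [u1 u2] [v1 v2]; rewrite /pb_diff /=.
by rewrite !linearP /= scalerDr addrACA.
Qed.
HB.instance Definition _ := GRing.isLinear.Build R (P * F)%type A _ pb_diff
  pb_diff_is_linear.

Definition pullback : lmodType R := submod (kerm pb_diff).
Definition pb1 : {linear pullback -> P} :=
  fst \o (val : submod (kerm pb_diff) -> (P * F)%type).
Definition pb2 : {linear pullback -> F} :=
  snd \o (val : submod (kerm pb_diff) -> (P * F)%type).

Lemma pbE w : p (pb1 w) = q (pb2 w).
Proof. by apply/subr0_eq/eqP/(valP w). Qed.

Lemma pb_inj v w : pb1 v = pb1 w -> pb2 v = pb2 w -> v = w.
Proof.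
move=> e1 e2; apply: val_inj; move: e1 e2; rewrite /pb1 /pb2 /=.
by case: (val v) (val w) => [? ?] [? ?] /= -> ->.
Qed.

Lemma pb_exists u z : p u = q z -> exists2 w, pb1 w = u & pb2 w = z.
Proof.
move=> e; have uzP : (u, z) \in kerm pb_diff.
  by apply/eqP; rewrite /= /pb_diff /= e subrr.
by exists (@Submod _ _ (kerm pb_diff) _ uzP).
Qed.

Lemma pb_pair (X : lmodType R) (f : {linear X -> P}) (g : {linear X -> F}) :
  (forall x, p (f x) = q (g x)) -> exists h : {linear X -> pullback},
  (forall x, pb1 (h x) = f x) /\ (forall x, pb2 (h x) = g x).
Proof.
move=> fg.
have /choice[h hE] x : exists w, pb1 w = f x /\ pb2 w = g x.
  by have [w ? ?] := pb_exists (fg x); exists w.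
have [|H HE] := @linear_of R X pullback h; last first.
  by exists H; split=> x; rewrite HE; case: (hE x).
move=> a u v; apply: pb_inj; rewrite linearP.
  by rewrite (hE _).1 (hE u).1 (hE v).1 linearP.
by rewrite (hE _).2 (hE u).2 (hE v).2 linearP.
Qed.

End Pullback.
Arguments pb1 {R P F A} p q.
Arguments pb2 {R P F A} p q.

(** The fibre product Q of P and F over A maps onto F with kernel K and onto P with kernel L. With F
    the free cover of A, the first sequence splits and the second makes Q an extension of P by the
    syzygy of A; this is what drives the dimension shifting below. *)
Lemma pullback_short_exact (R : comNzRingType) (K P L F A : lmodType R)
    (k : {linear K -> P}) (p : {linear P -> A})
    (l : {linear L -> F}) (q : {linear F -> A}) :
  short_exact k p -> short_exact l q ->
  exists (Q : lmodType R) (i : {linear K -> Q}) (b : {linear Q -> F})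
         (j : {linear L -> Q}) (a : {linear Q -> P}),
  [/\ short_exact i b, short_exact j a,
      forall u, a (i u) = k u & forall u, b (j u) = l u].
Proof.
move=> [k_inj kp p_surj] [l_inj lq q_surj].
(* The embeddings of the kernels are [i] = (k, 0) and [j] = (0, l). *)
have [|i [i1 i2]] := @pb_pair R _ _ _ p q K k \0.
  by move=> u; rewrite [RHS]linear0; apply/kp; exists u.
have [|j [j1 j2]] := @pb_pair R _ _ _ p q L \0 l.
  by move=> u; rewrite [LHS]linear0; apply/esym/lq; exists u.
exists (pullback p q), i, (pb2 p q), j, (pb1 p q); split=> //; split.
- by move=> u v uv; apply: k_inj; rewrite -!i1 uv.
- move=> w; split=> [w0|[u <-]]; last exact: i2.
  have /kp[u uw] : p (pb1 p q w) = 0 by rewrite pbE w0 linear0.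
  by exists u; apply: (@pb_inj R _ _ _ p q); rewrite ?i1 ?i2.
- by move=> z; have [u uz] := p_surj (q z); have [w] := pb_exists uz; exists w.
- by move=> u v uv; apply: l_inj; rewrite -!j2 uv.
- move=> w; split=> [w0|[u <-]]; last exact: j1.
  have /lq[u uw] : q (pb2 p q w) = 0 by rewrite -pbE w0 linear0.
  by exists u; apply: (@pb_inj R _ _ _ p q); rewrite ?j1 ?j2.
- move=> u; have [z zu] := q_surj (p u).
  by have [w] := pb_exists (esym zu); exists w.
Qed.

(** * Free modules, syzygies and projective modules *)

Section Free.
Variable R : comNzRingType.
Implicit Types A B K N P Q : lmodType R.

Lemma freelift1 (K : choiceType) A (f : K -> A) k :
  freelift f << 1 *g k >> = f k.
Proof. by rewrite [LHS]liftU scale1r. Qed.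

Lemma free_ind (K : choiceType) (S : {freeg K / R} -> Prop) :
  S 0 -> (forall u v, S u -> S v -> S (u + v)) ->
  (forall a u, S u -> S (a *: u)) -> (forall k, S << 1 *g k >>) ->
  forall z, S z.
Proof.
move=> S0 SD SZ S1 z; rewrite -[z]freeg_sumE.
elim/big_ind: _ => // k _.
suff -> : << coeff k z *g k >> = coeff k z *: << 1 *g k >>.
  exact/SZ/S1.
by apply/eqP/freeg_eqP => l; rewrite coeffZ !coeffU mul1r.
Qed.

Lemma free_hom_ext (K : choiceType) A (f g : {linear {freeg K / R} -> A}) :
  (forall k, f << 1 *g k >> = g << 1 *g k >>) -> f =1 g.
Proof.
move=> fg; apply: free_ind => [|u v fu fv|a u fu|k]; last exact: fg.
- by rewrite !linear0.
- by rewrite !linearD /= fu fv.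
- by rewrite !linearZ /= fu.
Qed.

Lemma free_lift (K : choiceType) P A (p : {linear P -> A})
    (f : {linear {freeg K / R} -> A}) : surj p ->
  exists g : {linear {freeg K / R} -> P}, forall z, p (g z) = f z.
Proof.
move=> /choice[s sK]; exists (freelift (fun k => s (f << 1 *g k >>))).
apply: (free_hom_ext (f := p \o freelift _)) => k /=.
by rewrite freelift1 sK.
Qed.

Lemma aug_is_surj A : surj (aug A).
Proof. by move=> a; exists << 1 *g a >>; rewrite aug_surj. Qed.

Definition syz_incl A : {linear syz A 1 -> {freeg A / R}} :=
  (val : submod (kerm (aug A)) -> {freeg A / R}).
Arguments syz_incl : simpl never.

Lemma syz_short_exact A : short_exact (syz_incl A) (aug A).
Proof. exact/ker_short_exact/aug_is_surj. Qed.

Lemma aug_syz A u : aug A (syz_incl A u) = 0.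
Proof. by have [_ sA _] := syz_short_exact A; apply/sA; exists u. Qed.

Lemma dresE A n z : dres A n z = syz_incl (syz A n) (aug (syz A n.+1) z).
Proof. by []. Qed.

Lemma syzSr A n : syz A n.+1 = syz (syz A 1) n.
Proof. by elim: n => //= n ->. Qed.

Definition projective P : Prop :=
  exists K : choiceType, retract P {freeg K / R}.

Lemma free_projective (K : choiceType) : projective {freeg K / R}.
Proof. by exists K, idfun, idfun. Qed.

(** The map id - s p takes values in the kernel of p, hence factors through k. *)
Lemma section_retraction K P A (k : {linear K -> P}) (p : {linear P -> A})
    (s : {linear A -> P}) :
  short_exact k p -> (forall a, p (s a) = a) ->
  exists r : {linear P -> K}, cancel k r.
Proof.
move=> [k_inj kp _] sK.
have [|r rE] := lift_inj (f := idfun \- (s \o p)) k_inj.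
  by move=> u; apply/kp; rewrite /= linearB /= sK subrr.
exists r => u; apply: k_inj; rewrite rE /=.
have -> : p (k u) = 0 by apply/kp; exists u.
by rewrite linear0 subr0.
Qed.

Lemma free_split (K : choiceType) (X P : lmodType R) (k : {linear X -> P})
    (p : {linear P -> {freeg K / R}}) : short_exact k p ->
  exists r : {linear P -> X}, cancel k r.
Proof.
move=> kp; case: (kp) => _ _ p_surj.
by have [s sK] := free_lift idfun p_surj; apply: (section_retraction kp sK).
Qed.

(** The cover of A is free on the underlying set of A, so f acts on bases. This makes the standard
    resolution functorial on the nose, and retracts pass to syzygies. *)
Lemma syz_map A B (f : {linear A -> B}) :
  exists (F : {linear {freeg A / R} -> {freeg B / R}})
         (g : {linear syz A 1 -> syz B 1}),
  (forall a, F << 1 *g a >> = << 1 *g f a >>) /\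
  (forall u, syz_incl B (g u) = F (syz_incl A u)).
Proof.
pose F := freelift (fun a => << 1 *g f a >> : {freeg B / R}).
have augF z : aug B (F z) = f (aug A z).
  apply: (free_hom_ext (f := aug B \o F) (g := f \o aug A)) => a /=.
  by rewrite freelift1 !aug_surj.
have [iA kA _] := syz_short_exact A; have [iB kB _] := syz_short_exact B.
have [|g gE] := lift_inj (f := F \o syz_incl A) iB.
  move=> u; apply/kB; rewrite /= augF.
  have -> : aug A (syz_incl A u) = 0 by apply/kA; exists u.
  by rewrite linear0.
exists F, g; split=> // a; exact: freelift1.
Qed.

Lemma syz1_retract A B : retract A B -> retract (syz A 1) (syz B 1).
Proof.
move=> [i [r iK]].
have [F [f [FE fE]]] := syz_map i; have [G [g [GE gE]]] := syz_map r.
exists f, g => u; have [iA _ _] := syz_short_exact A; apply: iA.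
rewrite gE fE; apply: (free_hom_ext (f := G \o F) (g := idfun)) => a /=.
by rewrite FE GE iK.
Qed.

Lemma syz_retract n A B : retract A B -> retract (syz A n) (syz B n).
Proof. by elim: n => // n IHn AB; apply: (syz1_retract (IHn AB)). Qed.

Lemma syz_projective P n : projective P -> projective (syz P n).
Proof.
elim: n => // n IHn /IHn [K PK]; exists {freeg K / R}.
have := syz1_retract PK; move=> /retract_trans; apply.
have [r rK] := free_split (syz_short_exact {freeg K / R}).
by exists (syz_incl _), r.
Qed.

End Free.

(** * Vanishing of Ext and Tor *)

Section ExtVanishing.
Variable R : comNzRingType.
Implicit Types A B K L N P Q : lmodType R.

(** This is Ext^1(A, N) = 0, read off the free cover of A: Ext^1 is the cokernel of restriction from
    the free module to the syzygy. *)
Definition ext1_zero A N : Prop :=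
  forall g : {linear syz A 1 -> N},
    exists h : {linear {freeg A / R} -> N}, forall u, h (syz_incl A u) = g u.

Lemma homology_zero A B N (f : {linear A -> B}) (g : {linear B -> N}) :
  zero_module (homology f g) <-> forall v, g v = 0 -> exists u, f u = v.
Proof.
split=> [H0 v /eqP gv|fg z].
  have := H0 (quotm_pi _ (@Submod _ _ (kerm g) v gv)).
  rewrite -[0](raddf0 (quotm_pi _)) => /quotm_pi_eqP.
  by rewrite subr0 => /asboolP.
rewrite -[z]quotm_pi_repr -[0](raddf0 (quotm_pi _)); apply/quotm_pi_eqP.
by rewrite subr0; apply/asboolP/fg/eqP/(valP (repr z)).
Qed.

(** A cocycle in degree j+1 kills the boundaries, so it is a map on [syz A j.+1], the first syzygy
    of [syz A j]; it is a coboundary exactly when that map extends to [res A j]. *)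
Lemma Ext_zeroP A N j : zero_module (Ext j.+1 A N) <-> ext1_zero (syz A j) N.
Proof.
rewrite homology_zero; have [_ dA _] := syz_short_exact (syz A j).
split=> [dN g|E v v0].
  have [|u uE] := dN (g \o aug (syz A j.+1)).
    apply: homP => z; rewrite -[LHS]/(g (aug _ (dres A j.+1 z))).
    by rewrite dresE aug_syz linear0.
  exists u => w; have [z <-] := aug_is_surj w.
  by move/(congr1 (fun f : {linear _ -> _} => f z)): uE.
have [|g gE] := factor_surj (p := aug (syz A j.+1)) (f := v) (@aug_is_surj _ _).
  have [_ dB _] := syz_short_exact (syz A j.+1).
  move=> z /dB[u <-]; have [w <-] := aug_is_surj u.
  by move/(congr1 (fun f : {linear _ -> _} => f w)): v0.
by have [h hE] := E g; exists h; apply: homP => z; rewrite -gE -hE.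
Qed.

(** The extension property of the free cover carries over to any injection with cokernel A, because
    P is a quotient of the sum of K and the free cover. *)
Lemma ext1_extend K P A N (k : {linear K -> P}) (p : {linear P -> A}) :
  short_exact k p -> ext1_zero A N -> forall g : {linear K -> N},
  exists h : {linear P -> N}, forall u, h (k u) = g u.
Proof.
move=> [k_inj kp p_surj] E g; have [iA sA aA] := syz_short_exact A.
have [f fE] := free_lift (aug A) p_surj.
have [|r rE] := lift_inj (f := f \o syz_incl A) k_inj.
  by move=> u; apply/kp; rewrite /= fE; apply/sA; exists u.
have [h hE] := E (g \o r).
have [s1 s1E] : exists s : {linear (K * {freeg A / R})%type -> P},
    forall w, s w = k w.1 + f w.2 by exists ((k \o fst) \+ (f \o snd)).
have [s2 s2E] : exists s : {linear (K * {freeg A / R})%type -> N},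
    forall w, s w = g w.1 + h w.2 by exists ((g \o fst) \+ (h \o snd)).
have [u|[u z]|H HE] := factor_surj (p := s1) (f := s2).
- have [z zE] := aA (p u).
  have /kp[v vE] : p (u - f z) = 0 by rewrite linearB /= fE zE subrr.
  by exists (v, z); rewrite s1E /= vE subrK.
- rewrite s1E s2E /= => uz0.
  have pk : p (k u) = 0 by apply/kp; exists u.
  have /sA[w wz] : aug A z = 0.
    by rewrite -fE -[LHS]add0r -pk -linearD /= uz0 linear0.
  (* The kernel of [s1] consists of the pairs (- r w, w) with w in the syzygy, and [s2] vanishes on
     them since h restricts to g r. *)
  have -> : u = - r w.
    apply: k_inj; rewrite linearN; apply/eqP.
    by rewrite -addr_eq0 (rE w) -[X in _ + X]/(f (syz_incl A w)) wz uz0.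
  by rewrite -wz hE linearN /= addNr.
exists H => u; have := HE (u, 0).
by rewrite s1E s2E /= !linear0 !addr0.
Qed.

(** A map on the syzygy of A extends to the fibre product Q since Ext^1(P, N) = 0. Subtracting a map
    pulled back from P makes the extension vanish on K without changing it on the syzygy, so that it
    descends to the free cover. *)
Lemma ext1_of_extend K P A N (k : {linear K -> P}) (p : {linear P -> A}) :
  short_exact k p -> ext1_zero P N ->
  (forall g : {linear K -> N},
     exists h : {linear P -> N}, forall u, h (k u) = g u) ->
  ext1_zero A N.
Proof.
move=> kp EP ext g; have [_ kpE _] := kp.
have [Q [i [b [j [a [i_ex j_ex iE jE]]]]]] :=
  pullback_short_exact kp (syz_short_exact A).
have [g' g'E] := ext1_extend j_ex EP g.
have [h hE] := ext (g' \o i).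
have [_ iex b_surj] := i_ex; have [_ jex _] := j_ex.
have [w /iex[u <-]|H HE] :=
    factor_surj (f := g' \- (h \o a)) b_surj.
  by rewrite /= iE hE /= subrr.
exists H => u; rewrite -jE HE /= g'E.
have -> : a (j u) = 0 by apply/jex; exists u.
by rewrite linear0 subr0.
Qed.

Lemma ext1_retract A B N : retract A B -> ext1_zero B N -> ext1_zero A N.
Proof.
move=> [i [r iK]] E g.
have [F [f [FE fE]]] := syz_map i; have [G [s [GE sE]]] := syz_map r.
have [h hE] := E (g \o s); exists (h \o F) => u /=.
rewrite -fE hE /=; congr (g _); have [iA _ _] := syz_short_exact A.
apply: iA; rewrite sE fE; apply: (free_hom_ext (f := G \o F) (g := idfun)) => a /=.
by rewrite FE GE iK.
Qed.

Lemma ext1_projective P N : projective P -> ext1_zero P N.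
Proof.
move=> [K /ext1_retract]; apply=> g.
have [r rK] := free_split (syz_short_exact {freeg K / R}).
by exists (g \o r) => u /=; rewrite rK.
Qed.

(** The index is shifted by one: this is Ext^(n+1)(A, N) = 0. *)
Definition ext_zero n A N : Prop := ext1_zero (syz A n) N.

Lemma ext_zeroS n A N : ext_zero n.+1 A N = ext_zero n (syz A 1) N.
Proof. by rewrite /ext_zero syzSr. Qed.

Lemma ext_zero_retract n A B N :
  retract A B -> ext_zero n B N -> ext_zero n A N.
Proof. by move=> AB; apply/ext1_retract/syz_retract. Qed.

Lemma ext_zero_projective n P N : projective P -> ext_zero n P N.
Proof. by move=> projP; apply/ext1_projective/syz_projective. Qed.

(* The long exact sequence of Ext(-, N) for 0 -> K -> P -> A -> 0 is only used
   for its vanishing consequences, which are obtained by dimension shifting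
   along pullbacks of the free cover of A. *)
Lemma ext_zero_step n N :
  (forall K P A (k : {linear K -> P}) (p : {linear P -> A}), short_exact k p ->
     ext_zero n A N -> ext_zero n K N -> ext_zero n P N) ->
  forall K P A (k : {linear K -> P}) (p : {linear P -> A}), short_exact k p ->
    ext_zero n P N -> ext_zero n.+1 A N -> ext_zero n K N.
Proof.
move=> mid K P A k p kp VP VA.
have [Q [i [b [j [a [i_ex j_ex _ _]]]]]] :=
  pullback_short_exact kp (syz_short_exact A).
(* K is a summand of Q, and Q is an extension of P by the syzygy of A, to which [mid] applies. *)
have [r iK] := free_split i_ex.
apply: (@ext_zero_retract _ _ Q); first by exists i, r.
apply: (mid _ _ _ _ _ j_ex) => //.
by rewrite -ext_zeroS.
Qed.

(** The free cover of P also covers A. The kernel W of that second cover plays the role of a syzygy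
    of A and is an extension of K by the syzygy of P. *)
Lemma cover_kernel K P A (k : {linear K -> P}) (p : {linear P -> A}) :
  short_exact k p -> exists (W : lmodType R) (w : {linear W -> {freeg P / R}})
    (c : {linear W -> K}) (v : {linear syz P 1 -> W}),
  [/\ short_exact w (p \o aug P), short_exact v c &
      forall u, w (v u) = syz_incl P u].
Proof.
move=> [k_inj kpE p_surj]; have [iP sP aP] := syz_short_exact P.
have q_surj : surj (p \o aug P).
  by move=> a; have [u <-] := p_surj a; have [z <-] := aP u; exists z.
have [W [w w_ex]] := kernel_exists q_surj.
have [iW sW _] := w_ex.
have [|v vE] := lift_inj (f := syz_incl P) iW.
  by move=> u; apply/sW; rewrite /= aug_syz linear0.
have [|c cE] := lift_inj (f := aug P \o w) k_inj.
  by move=> u; apply/kpE; apply/(sW _).2; exists u.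
exists W, w, c, v; split=> //; split=> [u u' e|u|u].
- by apply: iP; rewrite -!vE e.
- split=> [c0|[t <-]].
    have /sP[t tE] : aug P (w u) = 0 by have := cE u; rewrite c0 linear0.
    by exists t; apply: iW; rewrite vE.
  by apply: k_inj; rewrite cE linear0 -[LHS]/(aug P (w (v t))) vE aug_syz.
- have [z zE] := aP (k u); have /sW[t tE] : (p \o aug P) z = 0.
    by rewrite /= zE; apply/kpE; exists u.
  by exists t; apply: k_inj; rewrite cE -[LHS]/(aug P (w t)) tE.
Qed.

Lemma ext_zero_mid n K P A N (k : {linear K -> P}) (p : {linear P -> A}) :
  short_exact k p -> ext_zero n A N -> ext_zero n K N -> ext_zero n P N.
Proof.
elim: n K P A k p => [|n IHn] K P A k p /cover_kernel[W [w [c [v]]]].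
  (* A map on the syzygy of P extends first to W, with cokernel K, and then to the free cover, with
     cokernel A. *)
  move=> [w_ex v_ex vE] VA VK g; have [h hE] := ext1_extend v_ex VK g.
  have [h' h'E] := ext1_extend w_ex VA h.
  by exists h' => u; rewrite -vE h'E hE.
move=> [w_ex v_ex _] VA VK; rewrite ext_zeroS.
apply: (ext_zero_step IHn v_ex) => //; apply: (ext_zero_step IHn w_ex) => //.
exact/ext_zero_projective/free_projective.
Qed.

Lemma ext_zero_left n K P A N (k : {linear K -> P}) (p : {linear P -> A}) :
  short_exact k p -> ext_zero n P N -> ext_zero n.+1 A N -> ext_zero n K N.
Proof. by apply: ext_zero_step => *; apply: ext_zero_mid; eauto. Qed.

(** Q is an extension of a free module by K, which gives the vanishing for Q; Q modulo the syzygy of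
    A is P, which then gives it for that syzygy. *)
Lemma ext_zero_right n K P A N (k : {linear K -> P}) (p : {linear P -> A}) :
  short_exact k p -> ext_zero n K N -> ext_zero n.+1 P N -> ext_zero n.+1 A N.
Proof.
move=> kp VK VP; rewrite ext_zeroS.
have [Q [i [b [j [a [i_ex j_ex _ _]]]]]] :=
  pullback_short_exact kp (syz_short_exact A).
apply: (ext_zero_left j_ex) => //; apply: (ext_zero_mid i_ex) => //.
exact/ext_zero_projective/free_projective.
Qed.

End ExtVanishing.

(** * Short exact sequences in the second variable of Ext *)

Section ExtSecondVariable.
Variables (R : comNzRingType) (A : lmodType R).
Implicit Types N : lmodType R.

Lemma ext1_retract_r N N' : retract N N' -> ext1_zero A N' -> ext1_zero A N.
Proof.
move=> [i [r iK]] E g; have [h hE] := E (i \o g).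
by exists (r \o h) => u; rewrite -[LHS]/(r (h (syz_incl A u))) hE /= iK.
Qed.

Variables (N' N N'' : lmodType R).
Variables (j : {linear N' -> N}) (q : {linear N -> N''}).
Hypothesis jq : short_exact j q.

Lemma ext1_lift : ext1_zero A N' -> forall f : {linear A -> N''},
  exists g : {linear A -> N}, forall u, q (g u) = f u.
Proof.
have [j_inj jqE q_surj] := jq; have [_ sA aA] := syz_short_exact A => E f.
have [h hE] := free_lift (f \o aug A) q_surj.
have [|t tE] := lift_inj (f := h \o syz_incl A) j_inj.
  by move=> u; apply/jqE; rewrite hE -[LHS]/(f (aug A _)) aug_syz linear0.
have [e eE] := E t.
have [|g gE] := factor_surj (f := h \- (j \o e)) aA.
  (* On the syzygy the lift [h] takes values in N', and [e] extends this obstruction to the free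
     cover; the corrected lift descends to A. *)
  by move=> z /sA[u <-]; rewrite /= eE tE subrr.
exists g => u; have [z <-] := aA u.
rewrite gE /= linearB /= hE -[RHS]subr0; congr (_ - _).
by apply/jqE; exists (e z).
Qed.

Lemma ext1_of_lift : ext1_zero A N ->
  (forall f : {linear A -> N''},
     exists g : {linear A -> N}, forall u, q (g u) = f u) -> ext1_zero A N'.
Proof.
have [j_inj jqE q_surj] := jq; have [_ sA aA] := syz_short_exact A => E lift g.
have [h hE] := E (j \o g).
have [|f fE] := factor_surj (f := q \o h) aA.
  by move=> z /sA[u <-]; rewrite /= hE; apply/jqE; exists (g u).
have [f' f'E] := lift f.
have [|e eE] := lift_inj (f := h \- (f' \o aug A)) j_inj.
  by move=> z; apply/jqE; rewrite /= linearB /= f'E fE subrr.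
exists e => u; apply: j_inj; rewrite eE -[LHS]/(h _ - f' (aug A _)).
by rewrite aug_syz linear0 subr0 hE.
Qed.

(** Lifting of maps from the syzygy links Ext^1(A, N'') with Ext^1(syz A 1, N'), that is with
    Ext^2(A, N'). *)
Lemma ext1_quotient :
  ext1_zero A N -> (forall f : {linear syz A 1 -> N''},
     exists g : {linear syz A 1 -> N}, forall u, q (g u) = f u) ->
  ext1_zero A N''.
Proof.
move=> E lift g; have [f fE] := lift g; have [h hE] := E f.
by exists (q \o h) => u; rewrite -fE -hE.
Qed.

Lemma ext1_lift_syz : ext1_zero A N'' -> forall f : {linear syz A 1 -> N''},
  exists g : {linear syz A 1 -> N}, forall u, q (g u) = f u.
Proof.
have [_ _ q_surj] := jq => E f; have [h hE] := E f.
by have [g gE] := free_lift h q_surj; exists (g \o syz_incl A) => u; rewrite gE.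
Qed.

End ExtSecondVariable.

(** * Right exactness of the tensor product and flatness of free modules *)

Section TensorProducts.
Variable R : comNzRingType.
Implicit Types U V W A B N : lmodType R.

Lemma tensor_ind U V (S : tensor U V -> Prop) :
  S 0 -> (forall s t, S s -> S t -> S (s + t)) ->
  (forall u v, S (tens u v)) -> forall t, S t.
Proof.
move=> S0 SD St t; rewrite -[t]quotm_pi_repr; set z := repr t.
(* S is not assumed closed under scaling; the scalar is carried along and absorbed into the left
   factor of a pure tensor. *)
suff: forall a, S (a *: quotm_pi (spanm (@tensor_rel R U V)) z).
  by move/(_ 1); rewrite scale1r.
elim/free_ind: z => [|z z' Hz Hz'|b z Hz|[u v]] a.
- by rewrite [quotm_pi _ 0]raddf0 scaler0.
- by rewrite [quotm_pi _ _]raddfD scalerDr; apply: SD.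
- by rewrite [quotm_pi _ _]linearZ /= scalerA.
- by rewrite -[quotm_pi _ _]/(tens u v) -linearZl_LR; apply: St.
Qed.

Lemma tensor_hom_ext U V W (f g : {linear tensor U V -> W}) :
  (forall u v, f (tens u v) = g (tens u v)) -> f =1 g.
Proof.
move=> fg; apply: tensor_ind => [|s t fs ft|u v]; last exact: fg.
  by rewrite !linear0.
by rewrite !linearD fs ft.
Qed.

Lemma tensor_lift_exists U V W (b : U -> V -> W) :
  bilinear_for *:%R *:%R b ->
  exists h : {linear tensor U V -> W}, forall u v, h (tens u v) = b u v.
Proof.
move=> bL; pose b' : {bilinear U -> V -> W} :=
  HB.pack b (bilinear_isBilinear.Build R U V W _ _ b bL).
by exists (tensor_lift b') => u v; rewrite [LHS]tensor_lift_tens.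
Qed.

Section Bimap.
Variables (U U' V V' : lmodType R).
Variables (f : {linear U -> U'}) (g : {linear V -> V'}).

Definition tens_bimap (u : U) (v : V) : tensor U' V' := tens (f u) (g v).
Fact tens_bimap_is_bilinear : bilinear_for *:%R *:%R tens_bimap.
Proof.
by split=> [v a u u'|u a v v']; rewrite /tens_bimap ?linearP ?linearPl ?linearPr.
Qed.
HB.instance Definition _ :=
  bilinear_isBilinear.Build R U V (tensor U' V') _ _ tens_bimap
    tens_bimap_is_bilinear.

Definition tensor_bimap : {linear tensor U V -> tensor U' V'} :=
  tensor_lift tens_bimap.

Lemma tensor_bimap_tens u v : tensor_bimap (tens u v) = tens (f u) (g v).
Proof. exact: tensor_lift_tens. Qed.

Hypotheses (f_surj : surj f) (g_surj : surj g).

Lemma tensor_bimap_surj : surj tensor_bimap.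
Proof.
elim/tensor_ind => [|_ _ [s <-] [t <-]|u v]; first by exists 0; rewrite linear0.
  by exists (s + t); rewrite linearD.
have [u' <-] := f_surj u; have [v' <-] := g_surj v.
by exists (tens u' v'); rewrite tensor_bimap_tens.
Qed.

(** Right exactness in both variables at once: modulo S, the tensor of chosen preimages is
    independent of the choice, which defines a map from U' (x) V' whose composite with
    [tensor_bimap] is the projection modulo S. *)
Lemma tensor_bimap_ker (S : submodClosed (tensor U V)) :
  (forall u v, f u = 0 -> tens u v \in S) ->
  (forall u v, g v = 0 -> tens u v \in S) ->
  forall t, tensor_bimap t = 0 -> t \in S.
Proof.
move=> fS gS t t0.
have /choice[s sK] := f_surj; have /choice[r rK] := g_surj.
pose b u v : quotm S := quotm_pi S (tens (s u) (r v)).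
have bE u u' v v' : f u = f u' -> g v = g v' ->
    quotm_pi S (tens u v) = quotm_pi S (tens u' v').
  move=> uu vv; apply/quotm_pi_eqP.
  rewrite -(subrKA (tens u' v)) -linearBl -linearBr rpredD //.
    by apply: fS; rewrite linearB uu subrr.
  by apply: gS; rewrite linearB vv subrr.
have [|h hE] := @tensor_lift_exists U' V' (quotm S) b.
  split=> [v a u u'|u a v v']; rewrite /b -linearP.
    by rewrite -linearPl; apply: bE; rewrite // linearP !sK.
  by rewrite -linearPr; apply: bE; rewrite // linearP !rK.
have hK : h \o tensor_bimap =1 quotm_pi S.
  apply: tensor_hom_ext => u v.
  rewrite -[LHS]/(h (tensor_bimap _)) tensor_bimap_tens hE.
  by apply: bE; rewrite ?sK ?rK.
rewrite -[t]subr0; apply/quotm_pi_eqP.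
by rewrite -hK -[LHS]/(h (tensor_bimap t)) t0 !linear0.
Qed.

End Bimap.

Lemma tensor_mapE U U' V (d : {linear U -> U'}) :
  tensor_map V d =1 tensor_bimap d idfun.
Proof.
by apply: tensor_hom_ext => u v; rewrite tensor_bimap_tens [LHS]tensor_lift_tens.
Qed.

Lemma tensor_bimapC U U' V V' (f : {linear U -> U'}) (g : {linear V -> V'}) t :
  tensor_bimap f idfun (tensor_bimap idfun g t) =
  tensor_bimap idfun g (tensor_bimap f idfun t).
Proof.
elim/tensor_ind: t => [|s t IHs IHt|u v]; first by rewrite !linear0.
  by rewrite !linearD IHs IHt.
by rewrite !tensor_bimap_tens.
Qed.

Lemma tensor_bimap_compl U U' U'' V (f : {linear U -> U'})
    (g : {linear U' -> U''}) t :
  tensor_bimap (g \o f) (@idfun V) t =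
  tensor_bimap g idfun (tensor_bimap f idfun t).
Proof.
elim/tensor_ind: t => [|s t IHs IHt|u v]; first by rewrite !linear0.
  by rewrite !linearD IHs IHt.
by rewrite !tensor_bimap_tens.
Qed.

Lemma tensor_exact_l U U' U'' V (f : {linear U -> U'}) (g : {linear U' -> U''}) :
  exact_at f g -> surj g -> forall t, tensor_bimap g (@idfun V) t = 0 ->
  exists s, tensor_bimap f (@idfun V) s = t.
Proof.
move=> fg g_surj t t0; apply/asboolP.
apply: (@tensor_bimap_ker _ _ _ _ g idfun _ _
  (imgm (tensor_bimap f idfun)) _ _ t) => //.
- by move=> v; exists v.
- move=> _ v /fg[u <-]; apply/asboolP.
  by exists (tens u v); rewrite tensor_bimap_tens.
- by move=> u v v0; have -> : v = 0 := v0; rewrite linear0r rpred0.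
Qed.

Lemma tensor_exact_r U V V' V'' (f : {linear V -> V'}) (g : {linear V' -> V''}) :
  exact_at f g -> surj g -> forall t, tensor_bimap (@idfun U) g t = 0 ->
  exists s, tensor_bimap (@idfun U) f s = t.
Proof.
move=> fg g_surj t t0; apply/asboolP.
apply: (@tensor_bimap_ker _ _ _ _ idfun g _ _
  (imgm (tensor_bimap idfun f)) _ _ t) => //.
- by move=> v; exists v.
- by move=> u v u0; have -> : u = 0 := u0; rewrite linear0l rpred0.
- move=> u _ /fg[v <-]; apply/asboolP.
  by exists (tens u v); rewrite tensor_bimap_tens.
Qed.

Lemma free_coords (K : choiceType) N :
  exists c : K -> {linear tensor {freeg K / R} N -> N},
  forall k z n, c k (tens z n) = coeff k z *: n.
Proof.
suff /choice[c cE] : forall k, exists c : {linear tensor {freeg K / R} N -> N},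
  forall z n, c (tens z n) = coeff k z *: n by exists c.
move=> k; apply: tensor_lift_exists; split=> [n a z z'|z a n n'].
  by rewrite coeffD coeffZ scalerDl -scalerA.
by rewrite scalerDr scalerA mulrC -scalerA.
Qed.

Lemma free_expand (K : choiceType) (z : {freeg K / R}) (s : seq K) :
  uniq s -> {subset dom z <= s} -> z = \sum_(k <- s) coeff k z *: << 1 *g k >>.
Proof.
move=> s_uniq sub; apply/eqP/freeg_eqP => l; rewrite raddf_sum /=.
have cE k : coeff l (coeff k z *: << 1 *g k >>) = coeff k z * (k == l)%:R.
  by rewrite coeffZ coeffU mul1r.
rewrite (eq_bigr _ (fun k _ => cE k)).
have [ls|lNs] := boolP (l \in s).
  rewrite (bigD1_seq l) //= eqxx mulr1 big1 ?addr0 // => k /negPf->.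
  by rewrite mulr0.
rewrite coeff_outdom; last by apply: contra lNs; exact: sub.
rewrite big_seq big1 // => k ks; case: eqP => [kl|_]; last by rewrite mulr0.
by rewrite -kl ks in lNs.
Qed.

(** An element of the free module tensored with N' is determined by its coordinates in N', and j
    acts on each coordinate. *)
Lemma free_tensor_inj (K : choiceType) N' N (j : {linear N' -> N}) :
  injective j -> injective (tensor_bimap (@idfun {freeg K / R}) j).
Proof.
move=> j_inj; have [c' c'E] := free_coords K N'; have [c cE] := free_coords K N.
(* The expansion holds over every large enough list, so that two tensors can be expanded over a
   common one and added. *)
have expand t : exists s : seq K, forall s', uniq s' -> {subset s <= s'} ->
    t = \sum_(k <- s') tens << 1 *g k >> (c' k t).
  elim/tensor_ind: t => [|t t' [s sE] [s' s'E]|z n].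
  - exists [::] => s _ _; rewrite big1 // => k _.
    by rewrite linear0 linear0r.
  - exists (s ++ s') => r r_uniq sub.
    have /(sE r r_uniq) tE : {subset s <= r}.
      by move=> k ks; apply: sub; rewrite mem_cat ks.
    have /(s'E r r_uniq) t'E : {subset s' <= r}.
      by move=> k ks; apply: sub; rewrite mem_cat ks orbT.
    transitivity (\sum_(k <- r) (tens << 1 *g k >> (c' k t) +
        tens << 1 *g k >> (c' k t'))).
      by rewrite big_split -tE -t'E.
    by apply: eq_bigr => k _; rewrite -linearDr -linearD.
  - exists (dom z) => s s_uniq sub.
    rewrite {1}(free_expand s_uniq sub) linear_sumlz; apply: eq_bigr => k _.
    by rewrite c'E linearZl_LR linearZr_LR.
apply: ker0_inj => t t0.
have ct0 k : c' k t = 0.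
  apply: j_inj; rewrite linear0.
  have <- : c k (tensor_bimap idfun j t) = j (c' k t); last by rewrite t0 linear0.
  apply: (tensor_hom_ext (f := c k \o tensor_bimap idfun j)
    (g := j \o c' k)) => z n.
  rewrite -[LHS]/(c k (tensor_bimap _ _ _)) -[RHS]/(j (c' k _)).
  by rewrite tensor_bimap_tens cE c'E linearZ.
have [s sE] := expand t; rewrite (sE (undup s)) ?undup_uniq //.
  by rewrite big1 // => k _; rewrite ct0 linear0r.
by move=> k; rewrite mem_undup.
Qed.

End TensorProducts.

(** * Vanishing of Tor *)

Section TorVanishing.
Variable R : comNzRingType.
Implicit Types A B N : lmodType R.

Definition tor1_zero A N : Prop :=
  injective (tensor_bimap (syz_incl A) (@idfun N)).

(** As for [ext_zero], the index is shifted: this is Tor_(n+1)(A, N) = 0. *)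
Definition tor_zero n A N : Prop := tor1_zero (syz A n) N.

Lemma idfun_surj A : surj (@idfun A).
Proof. by move=> u; exists u. Qed.

(** By right exactness the chains modulo boundaries in degree j+1 are [syz A j.+1] (x) N, so the
    homology is the kernel of its map to [res A j] (x) N. *)
Lemma Tor_zeroP A N j : zero_module (Tor j.+1 A N) <-> tor_zero j A N.
Proof.
rewrite homology_zero /tor_zero; set B := syz A j.
have [_ dB _] := syz_short_exact (syz A j.+1).
have dres_tens i t : tensor_map N (dres A i) t =
    tensor_bimap (syz_incl (syz A i)) idfun
      (tensor_bimap (aug (syz A i.+1)) idfun t).
  by rewrite tensor_mapE -tensor_bimap_compl.
have aug_dres t : tensor_bimap (aug (syz A j.+1)) (@idfun N)
    (tensor_map N (dres A j.+1) t) = 0.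
  elim/tensor_ind: t => [|s t IHs IHt|u v]; first by rewrite !linear0.
    by rewrite !linearD IHs IHt addr0.
  by rewrite tensor_mapE !tensor_bimap_tens dresE aug_syz linear0l.
split=> [dd|inj v v0].
  apply: ker0_inj => s s0.
  have [v vs] := tensor_bimap_surj (@aug_is_surj _ (syz A j.+1))
    (@idfun_surj N) s.
  have [|u uE] := dd v; first by rewrite dres_tens vs.
  by rewrite -vs -uE aug_dres.
have {}v0 : tensor_bimap (aug (syz A j.+1)) idfun v = 0.
  by apply: inj; rewrite linear0 -dres_tens.
have [s <-] := tensor_exact_l dB (@aug_is_surj _ _) v0.
have [u us] := tensor_bimap_surj (@aug_is_surj _ (syz (syz A j.+1) 1))
    (@idfun_surj N) s.
by exists u; rewrite dres_tens us.
Qed.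

Lemma tor1_retract A N N' : retract N N' -> tor1_zero A N' -> tor1_zero A N.
Proof.
move=> [i [r iK]] inj; apply: ker0_inj => t t0.
have rK B s : tensor_bimap (@idfun B) r (tensor_bimap idfun i s) = s.
  elim/tensor_ind: s => [|s s' IHs IHs'|u v]; first by rewrite !linear0.
    by rewrite !linearD IHs IHs'.
  by rewrite !tensor_bimap_tens /= iK.
rewrite -[t]rK; have -> : tensor_bimap idfun i t = 0.
  by apply: inj; rewrite linear0 tensor_bimapC t0 linear0.
by rewrite linear0.
Qed.

Section SecondVariable.
Variables (A N' N N'' : lmodType R).
Variables (j : {linear N' -> N}) (q : {linear N -> N''}).
Hypotheses (jq : short_exact j q) (TN : tor1_zero A N).

Let iA : exact_at (syz_incl A) (aug A).
Proof. by have [] := syz_short_exact A. Qed.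

(** As Tor_1(A, N) = 0, the connecting map identifies Tor_1(A, N'') with the kernel of A (x) N' -> A
    (x) N. Both directions are snake chases; the first cancels j by flatness of the free cover, the
    second cancels the syzygy inclusion by [TN]. *)
Lemma tor1_tensor_inj :
  tor1_zero A N'' <-> injective (tensor_bimap (@idfun A) j).
Proof.
have [j_inj jqE q_surj] := jq; split=> inj; apply: ker0_inj.
  move=> s s0.
  have [v vs] := tensor_bimap_surj (@aug_is_surj _ A) (@idfun_surj _) s.
  have [|u uE] := @tensor_exact_l _ _ _ _ _ _ _ iA (@aug_is_surj _ A)
    (tensor_bimap idfun j v); first by rewrite tensor_bimapC vs.
  have [|w wE] := @tensor_exact_r _ _ _ _ _ _ _ jqE q_surj u.
    apply: inj; rewrite linear0 tensor_bimapC uE.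
    elim/tensor_ind: (v) => [|t t' IHt IHt'|a b]; first by rewrite !linear0.
      by rewrite !linearD IHt IHt' addr0.
    rewrite !tensor_bimap_tens; have -> : q (j b) = 0 by apply/jqE; exists b.
    by rewrite linear0r.
  have vw : v = tensor_bimap (syz_incl A) idfun w.
    by apply: (free_tensor_inj j_inj); rewrite -uE -wE tensor_bimapC.
  rewrite -vs vw; elim/tensor_ind: (w) => [|t t' IHt IHt'|a b].
  - by rewrite !linear0.
  - by rewrite !linearD IHt IHt' addr0.
  - by rewrite !tensor_bimap_tens aug_syz linear0l.
move=> t t0.
have [u ut] := tensor_bimap_surj (@idfun_surj (syz A 1)) q_surj t.
have [|v vE] := @tensor_exact_r _ _ _ _ _ _ _ jqE q_surj
  (tensor_bimap (syz_incl A) idfun u); first by rewrite -tensor_bimapC ut.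
have [|w wE] := @tensor_exact_l _ _ _ _ _ _ _ iA (@aug_is_surj _ A) v.
  apply: inj; rewrite linear0 -tensor_bimapC vE.
  elim/tensor_ind: (u) => [|s s' IHs IHs'|a b]; first by rewrite !linear0.
    by rewrite !linearD IHs IHs' addr0.
  by rewrite !tensor_bimap_tens aug_syz linear0l.
have uw : u = tensor_bimap idfun j w.
  by apply: TN; rewrite -vE -wE tensor_bimapC.
rewrite -ut uw; elim/tensor_ind: (w) => [|s s' IHs IHs'|a b].
- by rewrite !linear0.
- by rewrite !linearD IHs IHs' addr0.
- rewrite !tensor_bimap_tens; have -> : q (j b) = 0 by apply/jqE; exists b.
  by rewrite linear0r.
Qed.

(** The two paths from [syz A 1] (x) N' to the free cover tensored with N agree and both end in an
    injection, so their first maps are injective together. *)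
Lemma tor1_syz_inj :
  tor1_zero A N' <-> injective (tensor_bimap (@idfun (syz A 1)) j).
Proof.
have [j_inj _ _] := jq; split=> inj; apply: ker0_inj => t t0.
  apply: inj; rewrite linear0; apply: (free_tensor_inj j_inj).
  by rewrite -tensor_bimapC t0 !linear0.
apply: inj; rewrite linear0; apply: TN.
by rewrite tensor_bimapC t0 !linear0.
Qed.

End SecondVariable.
End TorVanishing.

(** * Quotients by exact zero-divisors *)

Section ExactPairs.
Variable R : comNzRingType.
Implicit Types (A B C N : lmodType R) (x y : R).

(** Exactness alone is what the homological criteria detect; the nontriviality conditions are
    handled separately. *)
Definition exact_pair x y N : Prop :=
  exact_at (mulm N x) (mulm N y) /\ exact_at (mulm N y) (mulm N x).

Lemma exact_pairC x y N : exact_pair x y N -> exact_pair y x N.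
Proof. by case. Qed.

Lemma exact_pair0 x y N (n : N) : exact_pair x y N -> y *: (x *: n) = 0.
Proof. by case=> xy _; apply/xy; exists n. Qed.

Lemma exact_pair_ker x y N : exact_pair x y N ->
  forall n : N, y *: n = 0 -> exists m, n = x *: m.
Proof. by case=> xy _ n /xy[m <-]; exists m. Qed.

Lemma exact_pairI x y N : (forall n : N, y *: (x *: n) = 0) ->
  (forall n : N, y *: n = 0 -> exists m, n = x *: m) ->
  (forall n : N, x *: n = 0 -> exists m, n = y *: m) -> exact_pair x y N.
Proof.
move=> yx0 kery kerx; split=> n; split=> [n0|[m <-]].
- by have [m ->] := kery n n0; exists m.
- exact: yx0.
- by have [m ->] := kerx n n0; exists m.
- by rewrite /= scalerA mulrC -scalerA; apply: yx0.
Qed.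

Lemma exact_pair_bij x y N N' (f : {linear N -> N'}) :
  injective f -> surj f -> exact_pair x y N -> exact_pair x y N'.
Proof.
move=> f_inj f_surj xyN; apply: exact_pairI => n'; have [n <-] := f_surj n'.
- by rewrite -!(linearZ_LR f) (exact_pair0 n xyN) linear0.
- rewrite -(linearZ_LR f) -[0](linear0 f) => /f_inj/(exact_pair_ker xyN)[m ->].
  by exists (f m); rewrite linearZ_LR.
- rewrite -(linearZ_LR f) -[0](linear0 f).
  move=> /f_inj/(exact_pair_ker (exact_pairC xyN))[m ->].
  by exists (f m); rewrite linearZ_LR.
Qed.

(** Since yx kills N, an element not killed by y lies outside xN; this turns xN <> N into the
    nonvanishing of yN. *)
Lemma exact_zero_divisorsP x y N : exact_pair x y N ->
  (exists n : N, x *: n <> 0) -> (exists n : N, y *: n <> 0) ->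
  exact_zero_divisors x y N.
Proof.
move=> xyN x0 [n y0]; case: (xyN) => ? ?; split=> //; exists n => -[m mE].
by apply: y0; rewrite -mE; apply: exact_pair0.
Qed.

Lemma exact_zero_divisors_pair x y N : exact_zero_divisors x y N ->
  exact_pair x y N.
Proof. by case. Qed.

Lemma exact_zero_divisors_neq0 x y N : exact_zero_divisors x y N ->
  (exists n : N, x *: n <> 0) /\ (exists n : N, y *: n <> 0).
Proof.
case=> x0 [n n_x] xy _; split=> //; exists n => yn0; apply: n_x.
by have /xy := yn0.
Qed.

Definition quot_pi N x : {linear N -> quot_by N x} := quotm_pi (imgm (mulm N x)).

Lemma quot_pi_surj N x : surj (quot_pi N x).
Proof. by move=> u; exists (repr u); apply: quotm_pi_repr. Qed.

Lemma quot_pi0 N x n : quot_pi N x n = 0 <-> exists m, n = x *: m.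
Proof.
rewrite -[0](linear0 (quot_pi N x)).
split=> [/quotm_pi_eqP|[m ->]]; last first.
  by apply/quotm_pi_eqP; rewrite subr0; apply/asboolP; exists m.
by rewrite subr0 => /asboolP[m <-]; exists m.
Qed.

Lemma quot_scale0 N x (n : quot_by N x) : x *: n = 0.
Proof.
have [m <-] := quot_pi_surj n; rewrite -(linearZ_LR (quot_pi N x)).
by apply/quot_pi0; exists m.
Qed.

Lemma quot_finite N x : finite_module N -> finite_module (quot_by N x).
Proof.
move=> [n [g gE]]; exists n, (quot_pi N x \o g) => m.
have [u <-] := quot_pi_surj m; have [a ->] := gE u; exists a.
by rewrite linear_sum; apply: eq_bigr => i _; rewrite linearZ_LR.
Qed.

(** Multiplication by x has kernel yN and image xN, so it embeds N/yN in N with cokernel N/xN. *)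
Lemma quot_short_exact x y N : exact_pair x y N ->
  exists k : {linear quot_by N y -> N},
    short_exact k (quot_pi N x) /\ forall n, k (quot_pi N y n) = x *: n.
Proof.
move=> xyN; have yxN := exact_pairC xyN.
have [|k kE] := factor_surj (f := mulm N x) (@quot_pi_surj N y).
  by move=> n /quot_pi0[m ->]; apply: exact_pair0 yxN.
exists k; split=> //; split; last exact: quot_pi_surj.
  apply: ker0_inj => n; have [m <-] := quot_pi_surj n; rewrite kE => xm0.
  by apply/quot_pi0/(exact_pair_ker yxN).
move=> n; split=> [/quot_pi0[m ->]|[u <-]]; first by exists (quot_pi N y m).
by have [m <-] := quot_pi_surj u; rewrite kE; apply/quot_pi0; exists m.
Qed.

Lemma quot_bij N N' x (f : {linear N -> N'}) : surj f ->
  (forall n, f n = 0 <-> exists m, n = x *: m) ->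
  retract (quot_by N x) N' /\ retract N' (quot_by N x).
Proof.
move=> f_surj f0.
have [|g gE] := factor_surj (f := f) (@quot_pi_surj N x).
  by move=> n /quot_pi0/f0.
apply: (bij_retract (f := g)).
  apply: ker0_inj => u; have [n <-] := quot_pi_surj u; rewrite gE => /f0 nx.
  exact/quot_pi0.
by move=> n'; have [n <-] := f_surj n'; exists (quot_pi N x n).
Qed.

(** Maps N/yN -> C are the maps f on N with yf = 0, and extending one along the embedding by x means
    writing f as xg. *)
Lemma ext1_quot_left x y N C : exact_pair x y N -> ext1_zero N C ->
  ext1_zero (quot_by N x) C <->
  forall f : {linear N -> C}, y *: f = 0 -> exists g, f = x *: g.
Proof.
move=> xyN EN; have [k [k_ex kE]] := quot_short_exact xyN; split=> [E f yf0|lift].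
  have [|f' f'E] := factor_surj (f := f) (@quot_pi_surj N y).
    move=> n /quot_pi0[m ->]; rewrite linearZ_LR.
    by move/(congr1 (fun h : {linear N -> C} => h m)): yf0.
  have [h hE] := ext1_extend k_ex E f'.
  exists h; apply: homP => n; rewrite -[RHS]/(x *: h n).
  by rewrite -(linearZ_LR h) -f'E -hE kE.
apply: (ext1_of_extend k_ex EN) => g.
have [|h hE] := lift (g \o quot_pi N y).
  apply: homP => n; rewrite -[LHS]/(y *: g (quot_pi N y n)).
  by rewrite -(linearZ_LR g) quot_scale0 linear0.
exists h => u; have [n <-] := quot_pi_surj u; rewrite kE linearZ_LR.
by move/(congr1 (fun h : {linear N -> C} => h n)): hE.
Qed.

(** A map A -> N killed by y lands in xN, a copy of N/yN; lifting it along N -> N/yN amounts to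
    dividing it by x. The kernel of that projection is a copy of N/xN. *)
Lemma ext1_quot_right x y A N : exact_pair x y N -> ext1_zero A N ->
  ext1_zero A (quot_by N x) <->
  forall f : {linear A -> N}, y *: f = 0 -> exists g, f = x *: g.
Proof.
move=> xyN EN; have yxN := exact_pairC xyN.
have [k [k_ex kE]] := quot_short_exact xyN; have [k_inj _ _] := k_ex.
have [l [l_ex lE]] := quot_short_exact yxN.
split=> [E f yf0|lift].
  have [u|f' f'E] := lift_inj (f := f) k_inj.
    have [|m ->] := @exact_pair_ker x y N xyN (f u).
      by move/(congr1 (fun h : {linear A -> N} => h u)): yf0.
    by exists (quot_pi N y m).
  have [g gE] := ext1_lift l_ex E f'.
  by exists g; apply: homP => u; rewrite -[RHS]/(x *: g u) -f'E -gE kE.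
apply: (ext1_of_lift l_ex EN) => f; have [|g gE] := lift (k \o f).
  apply: homP => u; rewrite -[LHS]/(y *: k (f u)).
  by have [n <-] := quot_pi_surj (f u); rewrite kE (exact_pair0 n xyN).
exists g => u; apply: k_inj; rewrite kE.
by move/(congr1 (fun h : {linear A -> N} => h u)): gE.
Qed.

Lemma tensor_quot_ker x A N t : tensor_bimap (@idfun A) (quot_pi N x) t = 0 ->
  exists s, t = x *: s.
Proof.
have: exact_at (mulm N x) (quot_pi N x).
  by move=> n; rewrite quot_pi0; split=> -[m]; exists m.
move=> /tensor_exact_r/(_ (@quot_pi_surj N x)) ker /ker[s <-].
exists s; elim/tensor_ind: s => [|s s' IHs IHs'|u v].
- by rewrite !linear0.
- by rewrite !linearD IHs IHs'.
- by rewrite tensor_bimap_tens -linearZr_LR.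
Qed.

Lemma tensor_scale0 x A N : (forall n : N, x *: n = 0) ->
  forall t : tensor A N, x *: t = 0.
Proof.
move=> xN; elim/tensor_ind => [|s s' IHs IHs'|u v]; first exact: scaler0.
  by rewrite scalerDr IHs IHs' addr0.
by rewrite -linearZr_LR xN linear0r.
Qed.

Lemma tensor_quot_surj x A N : surj (tensor_bimap (@idfun A) (quot_pi N x)).
Proof. exact: tensor_bimap_surj (@idfun_surj _ _) (@quot_pi_surj _ _). Qed.

(** The surjection A (x) N -> A (x) N/yN followed by the map induced by the embedding of N/yN is
    multiplication by x, so that map is injective exactly when x kills only multiples of y. *)
Lemma tor1_quot x y A N : exact_pair x y N -> tor1_zero A N ->
  tor1_zero A (quot_by N x) <->
  forall t : tensor A N, x *: t = 0 -> exists s, t = y *: s.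
Proof.
move=> xyN TN; have [k [k_ex kE]] := quot_short_exact xyN.
rewrite (tor1_tensor_inj k_ex TN).
have kx t : tensor_bimap (@idfun A) k (tensor_bimap idfun (quot_pi N y) t) = x *: t.
  elim/tensor_ind: t => [|s s' IHs IHs'|u v]; first by rewrite !linear0.
    by rewrite !linearD IHs IHs'.
  by rewrite !tensor_bimap_tens kE linearZr_LR.
split=> [inj t xt0|lift].
  by apply: tensor_quot_ker; apply: inj; rewrite kx linear0.
apply: ker0_inj => t'; have [t <-] := @tensor_quot_surj y A N t'.
rewrite kx => /lift[s ->]; rewrite linearZ_LR.
exact/tensor_scale0/quot_scale0.
Qed.

(** Vanishing of Ext^1 on N/xN and on N/yN gives the two kernel conditions, while yx = 0 is
    inherited from N. Shifting reduces all higher Ext to these two. *)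
Lemma exact_pair_hom_left x y N C : exact_pair x y N ->
  (forall n, ext_zero n N C) ->
  ((forall n, ext_zero n (quot_by N x) C) <-> exact_pair x y {linear N -> C}).
Proof.
move=> xyN EN; have yxN := exact_pairC xyN.
have shift n u v : exact_pair u v N ->
    ext_zero n.+1 (quot_by N u) C <-> ext_zero n (quot_by N v) C.
  move=> uvN; have [k [k_ex _]] := quot_short_exact uvN.
  by split=> E; [apply: (ext_zero_left k_ex)|apply: (ext_zero_right k_ex)].
split=> [E|xyH].
  apply: exact_pairI.
  - move=> f; apply: homP => n; rewrite -[LHS]/(y *: (x *: f n)).
    by rewrite -!(linearZ_LR f) (exact_pair0 n xyN) linear0.
  - by apply/(ext1_quot_left xyN (EN 0)); apply: (E 0).
  (* Ext^1 of N/yN vanishes because Ext^2 of N/xN does. *)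
  - apply/(ext1_quot_left yxN (EN 0)); apply/(shift 0 x y xyN); exact: E.
(* The shift exchanges N/xN and N/yN, so the induction carries both. *)
suff E n : ext_zero n (quot_by N x) C /\ ext_zero n (quot_by N y) C.
  by move=> n; case: (E n).
elim: n => [|n [IHx IHy]]; last by split; [apply/(shift n x y)|apply/(shift n y x)].
split; first exact/(ext1_quot_left xyN (EN 0))/exact_pair_ker.
exact/(ext1_quot_left yxN (EN 0))/exact_pair_ker/exact_pairC.
Qed.

Lemma exact_pair_hom_right x y A N : exact_pair x y N ->
  (forall n, ext_zero n A N) ->
  ((forall n, ext_zero n A (quot_by N x)) <-> exact_pair x y {linear A -> N}).
Proof.
move=> xyN EN; have yxN := exact_pairC xyN.
have shift n u v : exact_pair u v N ->
    ext_zero n.+1 A (quot_by N v) <-> ext_zero n A (quot_by N u).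
  move=> uvN; have [k [k_ex _]] := quot_short_exact uvN; split=> E.
    exact: (ext1_quotient (EN n) (ext1_lift k_ex E)).
  exact: (ext1_of_lift k_ex (EN n.+1) (ext1_lift_syz k_ex E)).
split=> [E|xyH].
  apply: exact_pairI.
  - move=> f; apply: homP => n; rewrite -[LHS]/(y *: (x *: f n)).
    exact: exact_pair0.
  - by apply/(ext1_quot_right xyN (EN 0)); apply: (E 0).
  - apply/(ext1_quot_right yxN (EN 0)); apply/(shift 0 y x yxN); exact: E.
suff E n : ext_zero n A (quot_by N x) /\ ext_zero n A (quot_by N y).
  by move=> n; case: (E n).
elim: n => [|n [IHx IHy]]; last by split; [apply/(shift n y x)|apply/(shift n x y)].
split; first exact/(ext1_quot_right xyN (EN 0))/exact_pair_ker.
exact/(ext1_quot_right yxN (EN 0))/exact_pair_ker/exact_pairC.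
Qed.

Lemma exact_pair_tensor x y A N : exact_pair x y N ->
  (forall n, tor_zero n A N) ->
  ((forall n, tor_zero n A (quot_by N x)) <-> exact_pair x y (tensor A N)).
Proof.
move=> xyN TN; have yxN := exact_pairC xyN.
have shift n u v : exact_pair u v N ->
    tor_zero n.+1 A (quot_by N u) <-> tor_zero n A (quot_by N v).
  move=> uvN; have [k [k_ex _]] := quot_short_exact uvN.
  (* Both sides amount to injectivity of the embedding of N/vN tensored with the syzygy of index
     n+1. *)
  by rewrite /tor_zero (tor1_tensor_inj k_ex (TN n.+1)) (tor1_syz_inj k_ex (TN n)).
split=> [T|xyT].
  apply: exact_pairI.
  - move=> t; rewrite scalerA; apply: tensor_scale0 => n.
    by rewrite -scalerA (exact_pair0 n xyN).
  - apply/(tor1_quot yxN (TN 0)); apply/(shift 0 x y xyN); exact: T.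
  - by apply/(tor1_quot xyN (TN 0)); apply: (T 0).
suff T n : tor_zero n A (quot_by N x) /\ tor_zero n A (quot_by N y).
  by move=> n; case: (T n).
elim: n => [|n [IHx IHy]]; last by split; [apply/(shift n x y)|apply/(shift n y x)].
split; first exact/(tor1_quot xyN (TN 0))/exact_pair_ker/exact_pairC.
exact/(tor1_quot yxN (TN 0))/exact_pair_ker.
Qed.

End ExactPairs.

(** * G-projective, Bass and Auslander classes *)

Section Classes.
Variables (R : comNzRingType) (C M : lmodType R) (x y : R).
Implicit Types (A N : lmodType R).

Lemma tensZr A N (u : A) a (n : N) : tens u (a *: n) = a *: tens u n.
Proof. exact: linearZr_LR. Qed.

Lemma bij_surj A N (f : A -> N) : bijective f -> surj f.
Proof. by case=> g _ gK n; exists (g n). Qed.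

Lemma inj_surj_bij A N (f : A -> N) : injective f -> surj f -> bijective f.
Proof.
by move=> f_inj /choice[g gK]; exists g => // n; apply: f_inj; rewrite gK.
Qed.

Lemma exists_neq0 a A N :
  ((forall m : N, a *: m = 0) -> forall n : A, a *: n = 0) ->
  (exists n : A, a *: n <> 0) -> exists m : N, a *: m <> 0.
Proof.
move=> NA [n n0]; apply: contrapT => N0; apply: n0; apply: NA => m.
by apply: contrapT => m0; apply: N0; exists m.
Qed.

Hypothesis xyM : exact_zero_divisors x y M.
Let xyM' : exact_pair x y M := exact_zero_divisors_pair xyM.
Let yxM' : exact_pair y x M := exact_pairC xyM'.

(** If x or y killed N, it would kill M, against the hypothesis on M. *)
Lemma exact_zero_divisors_transfer N : exact_pair x y N ->
  (forall a, (forall n : N, a *: n = 0) -> forall m : M, a *: m = 0) ->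
  exact_zero_divisors x y N.
Proof.
move=> xyN NM; have [x0 y0] := exact_zero_divisors_neq0 xyM.
by apply: exact_zero_divisorsP => //; apply: exists_neq0 (NM _) _.
Qed.

Lemma biduality_linear A N :
  exists b : {linear N -> {linear {linear N -> A} -> A}}, b =1 @biduality R A N.
Proof. by apply: linear_of => a u v; apply: homP => f; apply: linearP. Qed.

(** For the converse, the dual of M/xM is identified with the dual of M modulo x, through the map
    [Phi] sending f to the map induced by yf. *)
Lemma G_class_quot : G_class C M ->
  (G_class C (quot_by M x) <-> exact_zero_divisors x y {linear M -> C}).
Proof.
case=> finM bijM extM.
have [bid_inj bid_surj] := (bij_inj bijM, bij_surj bijM).
have EM n : ext_zero n M C by apply/Ext_zeroP; case: (extM n.+1 isT).
have ED n : ext_zero n {linear M -> C} C.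
  by apply/Ext_zeroP; case: (extM n.+1 isT).
split=> [[_ _ extQ]|xyD].
  apply: exact_zero_divisors_transfer.
    apply/(exact_pair_hom_left xyM' EM) => n.
    by apply/Ext_zeroP; case: (extQ n.+1 isT).
  move=> a aD m; apply: bid_inj; apply: homP => f.
  rewrite -[LHS]/(f (a *: m)) -[RHS]/(f 0) linearZ_LR linear0.
  by move/(congr1 (fun h : {linear M -> C} => h m)): (aD f).
have {}xyD := exact_zero_divisors_pair xyD; have yxD := exact_pairC xyD.
pose pi := quot_pi M x; have pi_surj : surj pi := @quot_pi_surj _ M x.
have xyDD : exact_pair x y {linear {linear M -> C} -> C}.
  have [b bE] := biduality_linear C M.
  apply: (exact_pair_bij (f := b)) => // [m m'|phi].
    by rewrite !bE => /bid_inj.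
  by have [m mE] := bid_surj phi; exists m; rewrite bE.
have pi_dual_inj : injective (hom_map C pi).
  move=> h h' hh; apply: homP => u; have [m <-] := pi_surj u.
  by move/(congr1 (fun f : {linear M -> C} => f m)): hh.
have [|Phi PhiE] := lift_inj (f := mulm {linear M -> C} y) pi_dual_inj.
  move=> f; have [|h hE] := factor_surj (f := y *: f) pi_surj.
    move=> m /quot_pi0[m' ->]; rewrite -[LHS]/(y *: f _).
    by rewrite -(linearZ_LR f) (exact_pair0 m' xyM') linear0.
  by exists h; apply: homP => m; rewrite -hE.
have {}PhiE f m : Phi f (pi m) = y *: f m.
  by move/(congr1 (fun g : {linear M -> C} => g m)): (PhiE f).
have Phi_surj : surj Phi.
  move=> h; have [|f fE] := exact_pair_ker yxD (n := hom_map C pi h).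
    apply: homP => m; rewrite -[LHS]/(x *: h (pi m)).
    by rewrite -(linearZ_LR h) quot_scale0 linear0.
  exists f; apply: homP => u; have [m <-] := pi_surj u; rewrite PhiE.
  by move/(congr1 (fun g : {linear M -> C} => g m)): fE => /esym.
have Phi0 f : Phi f = 0 <-> exists g, f = x *: g.
  split=> [f0|[g ->]].
    apply: (exact_pair_ker xyD); apply: homP => m.
    by rewrite -[LHS]/(y *: f m) -PhiE f0.
  apply: homP => u; have [m <-] := pi_surj u; rewrite PhiE.
  rewrite -[LHS]/(y *: (x *: g m)).
  by rewrite -!(linearZ_LR g) (exact_pair0 m xyM') linear0.
split; first exact: quot_finite.
  apply: inj_surj_bij => [u u' uu|phi].
    (* For all f, f(ym) is the value of [Phi f] at u - u', which is 0; hence ym = 0 and m lies in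
       xM. *)
    have [m mE] := pi_surj (u - u'); apply/subr0_eq; rewrite -mE.
    apply/quot_pi0/(exact_pair_ker xyM')/bid_inj/homP => f.
    rewrite -[LHS]/(f (y *: m)) linearZ_LR -PhiE mE linearB -[RHS]/(f 0) linear0.
    move/(congr1 (fun g : {linear _ -> _} => g (Phi f))): uu => uu.
    by apply/eqP; rewrite subr_eq0; apply/eqP.
  (* The composite is evaluation at some m. As [Phi] kills xf, xm = 0, so m = ym', and phi is
     evaluation at the class of m'. *)
  have [m mE] := bid_surj (phi \o Phi).
  have {}mE f : phi (Phi f) = f m.
    by move/(congr1 (fun g : {linear _ -> _} => g f)): mE.
  have [|m' m'E] := exact_pair_ker yxM' (n := m).
    apply: bid_inj; apply: homP => f.
    rewrite -[LHS]/(f (x *: m)) -[RHS]/(f 0) linear0 linearZ_LR.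
    rewrite -[LHS]/((x *: f) m) -mE.
    by have -> : Phi (x *: f) = 0; [apply/Phi0; exists f|rewrite linear0].
  exists (pi m'); apply: homP => h; have [f <-] := Phi_surj h.
  by rewrite mE m'E -[LHS]/(Phi f (pi m')) PhiE linearZ_LR.
have EQ := (exact_pair_hom_left xyM' EM).2 xyD.
have EDQ := (exact_pair_hom_left xyD ED).2 xyDD.
have [_ QD] := quot_bij Phi_surj Phi0.
move=> [//|i] _; split; first exact/Ext_zeroP/EQ.
exact/Ext_zeroP/(ext_zero_retract QD)/EDQ.
Qed.

(** For the converse, reduction modulo x identifies Hom(C, M)/x with Hom(C, M/xM), and C (x) Hom(C,
    M) is a copy of M on which x, y are again exact. *)
Lemma Bass_class_quot : Bass_class C M ->
  (Bass_class C (quot_by M x) <-> exact_zero_divisors x y {linear C -> M}).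
Proof.
case=> bijM extM; have [ev_inj ev_surj] := (bij_inj bijM, bij_surj bijM).
have EM n : ext_zero n C M by apply/Ext_zeroP; case: (extM n.+1 isT).
have TH n : tor_zero n C {linear C -> M}.
  by apply/Tor_zeroP; case: (extM n.+1 isT).
have ev_tens A (c : C) (h : {linear C -> A}) : eval_map C A (tens c h) = h c.
  exact: tensor_lift_tens.
split=> [[_ extQ]|xyH].
  apply: exact_zero_divisors_transfer.
    apply/(exact_pair_hom_right xyM' EM) => n.
    by apply/Ext_zeroP; case: (extQ n.+1 isT).
  move=> a aH m; have [t <-] := ev_surj m.
  by rewrite -(linearZ_LR (eval_map C M)) (tensor_scale0 aH) linear0.
have {}xyH := exact_zero_divisors_pair xyH.
pose pi := quot_pi M x; have pi_surj : surj pi := @quot_pi_surj _ M x.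
have EQ := (exact_pair_hom_right xyM' EM).2 xyH.
have EQy := (exact_pair_hom_right yxM' EM).2 (exact_pairC xyH).
have xyT : exact_pair x y (tensor C {linear C -> M}).
  have [g' g'E] := lift_inj (f := idfun) ev_inj ev_surj.
  apply: (exact_pair_bij (f := g')) => //.
    by move=> u v uv; rewrite -[u]/(idfun u) -g'E uv g'E.
  by move=> t; exists (eval_map C M t); apply: ev_inj; rewrite g'E.
have [Psi PsiE] :
  exists Psi : {linear {linear C -> M} -> {linear C -> quot_by M x}},
    forall h c, Psi h c = pi (h c).
  have [|Psi PsiE] := @linear_of R {linear C -> M} {linear C -> quot_by M x}
      (fun h => pi \o h).
    by move=> a h h'; apply: homP => c; apply: (linearP pi).
  by exists Psi => h c; rewrite PsiE.
have Psi_surj : surj Psi.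
  move=> f; have [k [k_ex _]] := quot_short_exact xyM'.
  (* The kernel of M -> M/xM is a copy of M/yM, hence the need for Ext^1(C, M/yM) = 0. *)
  have [g gE] := ext1_lift k_ex (EQy 0) f.
  by exists g; apply: homP => c; rewrite PsiE gE.
have Psi0 h : Psi h = 0 <-> exists g, h = x *: g.
  split=> [h0|[g ->]].
    apply: (exact_pair_ker xyH); apply: homP => c; rewrite -[LHS]/(y *: h c).
    have /quot_pi0[m ->] : pi (h c) = 0 by rewrite -PsiE h0.
    exact: exact_pair0.
  by apply: homP => c; rewrite PsiE; apply/quot_pi0; exists (g c).
have ev_Psi t : eval_map C (quot_by M x) (tensor_bimap idfun Psi t) =
    pi (eval_map C M t).
  elim/tensor_ind: t => [|s s' IHs IHs'|c h]; first by rewrite !linear0.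
    by rewrite !linearD IHs IHs'.
  by rewrite tensor_bimap_tens !ev_tens PsiE.
split; last first.
  have [_ QD] := quot_bij Psi_surj Psi0.
  move=> [//|i] _; split; first exact/Ext_zeroP/EQ.
  apply/Tor_zeroP/(tor1_retract QD).
  exact: (exact_pair_tensor xyH TH).2.
have xH0 (h : {linear C -> quot_by M x}) : x *: h = 0.
  by apply: homP => c; apply: quot_scale0.
apply: inj_surj_bij; last first.
  move=> u; have [m <-] := pi_surj u; have [t <-] := ev_surj m.
  by exists (tensor_bimap idfun Psi t).
apply: ker0_inj => t'.
have [t <-] := tensor_bimap_surj (@idfun_surj R C) Psi_surj t'.
(* The evaluation of t lies in xM, so t = xs by injectivity, and x kills C (x) Hom(C, M/xM). *)
rewrite ev_Psi => /quot_pi0[m]; have [s <-] := ev_surj m.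
rewrite -(linearZ_LR (eval_map C M)) => /ev_inj ->.
by rewrite linearZ_LR (tensor_scale0 xH0).
Qed.

(** For the converse, C (x) M/xM is C (x) M modulo x, and multiplication by y embeds it in C (x) M
    through [q]; this carries the unit isomorphism from M to M/xM. *)
Lemma Auslander_class_quot : Auslander_class C M ->
  (Auslander_class C (quot_by M x) <-> exact_zero_divisors x y (tensor C M)).
Proof.
case=> bijM extM; have [un_inj un_surj] := (bij_inj bijM, bij_surj bijM).
have TM n : tor_zero n C M by apply/Tor_zeroP; case: (extM n.+1 isT).
have ET n : ext_zero n C (tensor C M) by apply/Ext_zeroP; case: (extM n.+1 isT).
have unE A (a : A) c : unit_map C a c = tens c a by [].
split=> [[_ extQ]|xyT].
  apply: exact_zero_divisors_transfer.
    apply/(exact_pair_tensor xyM' TM) => n.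
    by apply/Tor_zeroP; case: (extQ n.+1 isT).
  move=> a aT m; apply: un_inj; apply: homP => c.
  by rewrite !unE linear0r tensZr aT.
have {}xyT := exact_zero_divisors_pair xyT.
pose pi := quot_pi M x; have pi_surj : surj pi := @quot_pi_surj _ M x.
have xyH : exact_pair x y {linear C -> tensor C M}.
  have [|u uE] := @linear_of R M {linear C -> tensor C M} (@unit_map R C M).
    by move=> a m m'; apply: homP => c; rewrite !unE linearPr.
  apply: (exact_pair_bij (f := u)) => // [m m'|h].
    by rewrite !uE => /un_inj.
  by have [m mE] := un_surj h; exists m; rewrite uE.
pose p := tensor_bimap (@idfun C) pi.
have p_surj : surj p := @tensor_quot_surj R x C M.
have p0 t : p t = 0 <-> exists s, t = x *: s.
  split=> [/tensor_quot_ker //|[s ->]]; rewrite (linearZ_LR p).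
  exact/tensor_scale0/quot_scale0.
have [|q qE] := factor_surj (f := mulm (tensor C M) y) p_surj.
  by move=> t /p0[s ->]; apply: exact_pair0.
have q_inj : injective q.
  apply: ker0_inj => u; have [t <-] := p_surj u; rewrite qE => yt0.
  exact/p0/(exact_pair_ker xyT).
have TQ := (exact_pair_tensor xyM' TM).2 xyT.
have EQ := (exact_pair_hom_right xyT ET).2 xyH.
split; last first.
  have [_ QT] := quot_bij p_surj p0.
  move=> [//|i] _; split; first exact/Tor_zeroP/TQ.
  exact/Ext_zeroP/(ext1_retract_r QT)/EQ.
have pE c m : p (tens c m) = tens c (pi m) by apply: tensor_bimap_tens.
apply: inj_surj_bij => [u u' uu|h].
  have [m mE] := pi_surj (u - u'); apply/subr0_eq; rewrite -mE.
  apply/quot_pi0/(exact_pair_ker xyM')/un_inj/homP => c.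
  rewrite !unE linear0r tensZr.
  suff /p0[s ->] : p (tens c m) = 0 by apply: (exact_pair0 s xyT).
  rewrite pE mE linearBr; apply/eqP; rewrite subr_eq0; apply/eqP.
  exact: (congr1 (fun g : {linear _ -> _} => g c) uu).
(* Values of [q] are multiples of y, hence killed by x. So xm = 0, m = ym', and h is the unit map at
   the class of m' after cancelling [q]. *)
have [m mE] := un_surj (q \o h).
have {}mE c : q (h c) = tens c m.
  by move/(congr1 (fun g : {linear _ -> _} => g c)): mE.
have [|m' m'E] := exact_pair_ker yxM' (n := m).
  apply: un_inj; apply: homP => c; rewrite !unE linear0r tensZr -mE.
  have [t <-] := p_surj (h c); rewrite qE.
  exact: (exact_pair0 t (exact_pairC xyT)).
exists (pi m'); apply: homP => c; apply: q_inj.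
by rewrite unE -pE qE mE m'E tensZr.
Qed.

End Classes.

Theorem proposition4p5 (R : comNzRingType) (C M : lmodType R) (x y : R)
    (noethR : noetherian R) (semiC : semidualizing C)
    (xyR : exact_zero_divisors x y R^o) (xyM : exact_zero_divisors x y M) :
  [/\ G_class C M ->
        (G_class C (quot_by M x) <->
         exact_zero_divisors x y {linear M -> C}),
      Bass_class C M ->
        (Bass_class C (quot_by M x) <->
         exact_zero_divisors x y {linear C -> M}) &
      Auslander_class C M -> finite_module M ->
        (Auslander_class C (quot_by M x) <->
         exact_zero_divisors x y (tensor C M))].
Proof.
split=> [GM|BM|AM _]; first exact: G_class_quot.
  exact: Bass_class_quot.
exact: Auslander_class_quot.
Qed.
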